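(* Let $0<\alpha\le\infty$, let $0\ne g\in L_1[0,\alpha)+L_\infty[0,\alpha)$, let $k\in\mathbb{N}$ and let $f\in L_1[0,\alpha)+L_\infty[0,\alpha)$. Then the following are equivalent: (i) $f$ is an extreme point of $\Omega(g)$; (ii) $f$ is a $k$-extreme point of $\Omega(g)$; (iii) $\mu(f)$ is a $k$-extreme point of $\Omega(g)$ and $|f|\geq\mu(\infty,f)$ a.e. on $[0,\alpha)$; (iv) $\mu(f)=\mu(g)$ and $|f|\geq\mu(\infty,f)$ a.e. on $[0,\alpha)$.
   Context: Let $m$ be Lebesgue measure; functions are complex-valued and measurable on $[0,\alpha)$, mod a.e. equality; $L^0[0,\alpha)$ denotes the space of all of them. For such $f$, $d(\lambda,f)=m\{t:|f(t)|>\lambda\}$ and $\mu(t,f)=\inf\{s>0:d(s,f)\le t\}$, $t\ge0$, is its decreasing rearrangement; $\mu(\infty,f)=\lim_{t\to\infty}\mu(t,f)$. When $\alpha<\infty$, $\mu(t,f)=0$ for $t\ge\alpha$, and $\mu(f)$ is identified with its restriction to $[0,\alpha)$. Write $f\prec g$ if $\int_0^t\mu(f)\le\int_0^t\mu(g)$ for all $t>0$. The orbit of $g$ is $\Omega(g)=\{f\in L_1[0,\alpha)+L_\infty[0,\alpha): f\prec g\}$. Put $G(t)=\int_0^t\mu(g)$; the Marcinkiewicz space $M_G$ is the set of $f\in L^0[0,\alpha)$ with $\|f\|_{M_G}=\sup_{t>0}\frac{\int_0^t\mu(f)}{G(t)}<\infty$, normed by $\|\cdot\|_{M_G}$. Then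 $\Omega(g)$ is the closed unit ball $B_{M_G}$ of $M_G$, and extreme and $k$-extreme points of $\Omega(g)$ are understood as those of $B_{M_G}$. For $k\in\mathbb{N}$ and a complex normed space $X$ of dimension at least $k+1$ with unit sphere $S_X$ and closed unit ball $B_X$, a point $x\in S_X$ is a $k$-extreme point of $B_X$ if whenever $x=\frac1{k+1}\sum_{i=1}^{k+1}x_i$ with all $x_i\in S_X$, the elements $x_1,\dots,x_{k+1}$ are linearly dependent. ($1$-extreme points are exactly the extreme points of $B_X$.) *)

(* Defs.v *)
From mathcomp Require Import all_boot all_order all_algebra.
From mathcomp Require Import all_classical all_reals all_analysis.
From mathcomp.real_closed Require Import complex.

Set Implicit Arguments.
Unset Strict Implicit.
Unset Printing Implicit Defensive.

Import Order.TTheory GRing.Theory Num.Theory.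
Import numFieldNormedType.Exports.
Import Normc.

Local Open Scope classical_set_scope.
Local Open Scope ring_scope.
Local Open Scope ereal_scope.

(* An element of L^0[0, alpha) is represented by a function R -> R[i] that is
   Borel measurable on [0, alpha); its values outside [0, alpha) are irrelevant.
   Every Lebesgue measurable function is a.e. equal to a Borel measurable one.
   Equality of elements of L^0[0, alpha) is equality a.e. on [0, alpha). *)

Definition Ico0 {R : realType} (alpha : \bar R) : set R :=
  [set x | (0 <= x)%R /\ x%:E < alpha].

Definition aeq {R : realType} (alpha : \bar R) (f g : R -> R[i]) : Prop :=
  {ae @lebesgue_measure R, forall x, Ico0 alpha x -> f x = g x}.

Definition L0 {R : realType} (alpha : \bar R) : set (R -> R[i]) :=
  [set f | measurable_fun (Ico0 alpha) (fun x => complex.Re (f x)) /\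
           measurable_fun (Ico0 alpha) (fun x => complex.Im (f x))].

Definition L1 {R : realType} (alpha : \bar R) : set (R -> R[i]) :=
  [set f | L0 alpha f /\
    \int[@lebesgue_measure R]_(x in Ico0 alpha) (normc (f x))%:E < +oo].

Definition Linfty {R : realType} (alpha : \bar R) : set (R -> R[i]) :=
  [set f | L0 alpha f /\ exists M : R,
    {ae @lebesgue_measure R, forall x, Ico0 alpha x -> (normc (f x) <= M)%R}].

Definition L1_plus_Linfty {R : realType} (alpha : \bar R) : set (R -> R[i]) :=
  [set f | L0 alpha f /\ exists u v : R -> R[i],
    [/\ L1 alpha u, Linfty alpha v & aeq alpha f (fun x => u x + v x)%R]].

Definition distribution_fun {R : realType} (alpha : \bar R)
    (f : R -> R[i]) (s : R) : \bar R :=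
  @lebesgue_measure R (Ico0 alpha `&` [set x | (s < normc (f x))%R]).

(* The infimum is taken in \bar R, so that rearr alpha f 0 may be +oo. *)
Definition rearr {R : realType} (alpha : \bar R)
    (f : R -> R[i]) (t : R) : \bar R :=
  ereal_inf [set s%:E | s in
    [set s : R | (0 < s)%R /\ distribution_fun alpha f s <= t%:E]].

Definition rearr_infty {R : realType} (alpha : \bar R) (f : R -> R[i]) : \bar R :=
  lim (rearr alpha f t @[t --> +oo%R]).

(* mu(f) as an element of L^0[0, alpha). For f in L_1 + L_oo, the only t >= 0
   at which fine may change the value of mu(f) is t = 0. *)
Definition rearrC {R : realType} (alpha : \bar R) (f : R -> R[i]) : R -> R[i] :=
  fun t => ((fine (rearr alpha f t))%:C)%C.

Definition int_rearr {R : realType} (alpha : \bar R)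
    (f : R -> R[i]) (t : R) : \bar R :=
  \int[@lebesgue_measure R]_(s in `[0%R, t]) rearr alpha f s.

Definition submajorized {R : realType} (alpha : \bar R) (f g : R -> R[i]) : Prop :=
  forall t : R, (0 < t)%R -> int_rearr alpha f t <= int_rearr alpha g t.

Definition Omega {R : realType} (alpha : \bar R) (g : R -> R[i]) :
    set (R -> R[i]) :=
  [set f | L1_plus_Linfty alpha f /\ submajorized alpha f g].

(* The norm of the Marcinkiewicz space M_G, where G = int_rearr alpha g. *)
Definition marcinkiewicz_norm {R : realType} (alpha : \bar R)
    (g f : R -> R[i]) : \bar R :=
  ereal_sup [set int_rearr alpha f t / int_rearr alpha g t | t in
    [set t : R | (0 < t)%R]].

Definition marcinkiewicz {R : realType} (alpha : \bar R) (g : R -> R[i]) :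
    set (R -> R[i]) :=
  [set f | L0 alpha f /\ marcinkiewicz_norm alpha g f < +oo].

Definition marcinkiewicz_sphere {R : realType} (alpha : \bar R)
    (g : R -> R[i]) : set (R -> R[i]) :=
  [set f | marcinkiewicz alpha g f /\ marcinkiewicz_norm alpha g f = 1].

Definition extreme_point {R : realType} (alpha : \bar R)
    (C : set (R -> R[i])) (f : R -> R[i]) : Prop :=
  C f /\ forall (y z : R -> R[i]) (l : R), C y -> C z -> (0 < l < 1)%R ->
    aeq alpha f (fun t => l%:C%C * y t + (1 - l)%:C%C * z t)%R ->
    aeq alpha y f /\ aeq alpha z f.

Definition linearly_dependent {R : realType} (alpha : \bar R) (n : nat)
    (x : 'I_n -> R -> R[i]) : Prop :=
  exists c : 'I_n -> R[i], (exists i, c i <> 0%R) /\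
    aeq alpha (fun t => \sum_(i < n) c i * x i t)%R (fun=> 0%R).

(* f is a k-extreme point of Omega g, i.e. of the closed unit ball of M_G, with
   which Omega g coincides. M_G is infinite-dimensional, so the requirement
   dim M_G >= k + 1 always holds. *)
Definition k_extreme_point {R : realType} (alpha : \bar R) (g : R -> R[i])
    (k : nat) (f : R -> R[i]) : Prop :=
  marcinkiewicz_sphere alpha g f /\
  forall x : 'I_k.+1 -> R -> R[i],
    (forall i, marcinkiewicz_sphere alpha g (x i)) ->
    aeq alpha f (fun t => (k.+1%:R)^-1 * \sum_(i < k.+1) x i t)%R ->
    linearly_dependent alpha x.

(* Main.v *)
Require Import Defs.
From mathcomp Require Import all_boot all_order all_algebra.
From mathcomp Require Import all_classical all_reals all_analysis.
From mathcomp Require Import measurable_realfun.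
From mathcomp.real_closed Require Import complex.
From mathcomp Require Import ring lra.
Import Order.TTheory GRing.Theory Num.Theory.
Import numFieldNormedType.Exports.
Import Normc.
Local Open Scope ring_scope.
Local Open Scope ereal_scope.

(** For a level l >= 0, let the excess of f be the integral of (|f| - l)^+ over
    [0, alpha). As a functional of f it is convex, and it encodes everything that the
    theorem speaks of. Write F(t) for the integral of mu(f) over [0, t], and G(t) for
    that of mu(g).

    Since mu(t, f) > s if and only if d(s, f) > t, the layer cake formula shows that the
    excess of f is also the integral of (mu(f) - l)^+ (lt_rearr, excess_rearr). Hence
    F(t) <= t l + excess f l, with equality for l = mu(t, f), and in the other direction
    excess f l is the supremum of F(t) - t l over t. By this Legendre duality f is
    submajorized by g if and only if excess f l <= excess g l for all l (submajorizedP).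
    So the orbit of g is a convex set cut out by the excess functionals (OmegaP), and the
    unit sphere consists of its points that leave it when stretched (sphereP).

    Extreme points are k-extreme by convexity alone: if f is the average of k + 1 points
    of the orbit, it is a convex combination of any one of them and a point of the orbit,
    so that all of them are equal to f (extreme_k_extreme).

    Suppose that mu(f) = mu(g) and |f| >= mu(oo, f), and let f = a y + (1 - a) z with y
    and z in the orbit. At each level l > mu(oo, f) the excess is finite and its
    convexity inequality is an equality, hence an equality almost everywhere under the
    integral; so |y| <= l and |z| <= l wherever |f| <= l. Therefore |y| <= |f| and
    |z| <= |f|, and strict convexity of the modulus gives y = z = f
    (equimeasurable_extreme).

    Suppose finally that f is k-extreme. If excess f l + d <= excess g l, with d > 0, for
    all levels l near the values of |f| on a set E of finite positive measure, then small
    perturbations of |f| inside E with mean zero stay in the orbit: higher levels do not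
    see them, lower levels only see their mean, and at the levels in between there is
    room (Omega_perturb). One can choose k + 1 such perturbations with sum 0 that make f
    the average of k + 1 linearly independent points (perturb_not_k_extreme). So there is
    no such room. But there is, if |f| < mu(oo, f) on a set of positive measure, as both
    excesses are infinite below mu(oo, f); and if F(t) < G(t) for some t, at the levels
    near c = mu(t, f), an essential value of |f|, because
    excess f c = F(t) - t c < G(t) - t c <= excess g c. This proves |f| >= mu(oo, f) and
    mu(f) = mu(g) (k_extreme_ge_rearr_infty, k_extreme_eq_rearr).

    Since mu(mu(f)) = mu(f) and mu(f) >= mu(oo, f), the statement about mu(f) follows by
    applying the others to mu(f) in place of f. *)

Set Implicit Arguments.
Unset Strict Implicit.
Unset Printing Implicit Defensive.

Local Open Scope classical_set_scope.
Local Open Scope ring_scope.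
Local Open Scope ereal_scope.

(** * Comparison of extended reals and null sets *)

Section Preliminaries.
Context {R : realType}.
Local Notation m := (@lebesgue_measure R).
Implicit Types e s t : R.

Lemma eq_lte_EFin (x y : \bar R) : 0 <= x -> 0 <= y ->
  (forall s, (0 <= s)%R -> (s%:E < x) = (s%:E < y)) -> x = y.
Proof.
have H (a b : \bar R) : 0 <= a -> 0 <= b ->
  (forall s, (0 <= s)%R -> (s%:E < a) = (s%:E < b)) -> a <= b.
  move=> a0 b0 ab; case: b b0 ab => [b| |] // b0 ab; last by rewrite leey.
  by rewrite leNgt ab// ltxx.
by move=> x0 y0 xy; apply/le_anti/andP; split; apply: H => // s s0; rewrite xy.
Qed.

Lemma lt_EFin_shift t (y : \bar R) : t%:E < y -> exists2 e, (0 < e)%R & (t + e)%:E < y.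
Proof.
case: y => [y| |]//.
  rewrite lte_fin => ty; exists ((y - t) / 2)%R; first by lra.
  by rewrite lte_fin; lra.
by move=> _; exists 1%R => //; rewrite ltry.
Qed.

Lemma adde_cancel (x y z : \bar R) : x \is a fin_num -> x + y = x + z -> y = z.
Proof. by move=> xf /eqP; rewrite eq_le !leeD2lE// -eq_le => /eqP. Qed.

Lemma ae_and (P Q S : R -> Prop) : {ae m, forall x, P x} ->
  {ae m, forall x, Q x} -> (forall x, P x -> Q x -> S x) ->
  {ae m, forall x, S x}.
Proof.
move=> aeP aeQ PQS.
exact: (@filterS2 _ _ (ae_filter_ringOfSetsType m) _ _ _ PQS aeP aeQ).
Qed.

Lemma ae_imp (P Q : R -> Prop) : {ae m, forall x, P x} ->
  (forall x, P x -> Q x) -> {ae m, forall x, Q x}.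
Proof. by move=> aeP PQ; apply: (ae_and aeP aeP) => x _; exact: PQ. Qed.

Lemma ae_point (A : set R) (P : R -> Prop) : measurable A -> 0 < m A ->
  {ae m, forall x, P x} -> exists x, A x /\ P x.
Proof.
move=> mA A0 [N [mN N0 PN]]; apply: contrapT => /forallNP H.
suff : m A <= 0 by rewrite leNgt A0.
rewrite -N0; apply: le_measure; rewrite ?inE// => x Ax; apply: PN => /= Px.
by apply: (H x).
Qed.

Lemma ae_neq0 : {ae m, forall t : R, t <> 0%R}.
Proof.
exists [set 0%R]; split => //; first exact: lebesgue_measure_set1.
by move=> x /= /contrapT.
Qed.

Lemma eq_measure_off0 (A B : set R) : measurable A -> measurable B ->
  (forall t, t <> 0%R -> A t <-> B t) -> m A = m B.
Proof.
move=> mA mB AB.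
have H (X Y : set R) : measurable X -> measurable Y ->
    (forall t, t <> 0%R -> X t -> Y t) -> m X <= m Y.
  move=> mX mY XY; have m1 : measurable [set 0%R : R] by exact: measurable_set1.
  apply: (@le_trans _ _ (m (Y `|` [set 0%R]))).
    apply: le_measure; rewrite ?inE//; first exact: measurableU.
    by move=> t Xt; have [->|t0] := pselect (t = 0%R); [right|left; exact: XY].
  apply: le_trans (@measureU2 _ _ _ m _ _ mY m1) _.
  by rewrite [X in _ + X]lebesgue_measure_set1 adde0.
by apply/le_anti/andP; split; apply: H => // t t0; have [] := AB t t0.
Qed.

Lemma measure_bigcup_gt0 (F : nat -> set R) : (forall n, measurable (F n)) ->
  0 < m (\bigcup_n F n) -> exists n, 0 < m (F n).
Proof.
move=> mF; apply: contraPP => /forallNP H; apply/negP; rewrite -leNgt.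
have Z n : m (F n) = 0.
  by apply/le_anti/andP; split; [rewrite leNgt; exact/negP/H|exact: measure_ge0].
have mU : measurable (\bigcup_n F n) by exact: bigcup_measurable.
apply: le_trans (@measure_sigma_subadditive _ _ _ m _ _ mF mU (@subset_refl _ _)) _.
by rewrite eseries0// => n _ _; exact: Z.
Qed.

End Preliminaries.

(** * The distribution function and the layer cake formula *)

Section LayerCake.
Context {R : realType}.
Local Notation m := (@lebesgue_measure R).

Lemma measurable_Ico0 (y : \bar R) : measurable (Ico0 y).
Proof.
apply: is_interval_measurable => a b /= [a0 ay] [b0 bY] c /andP[ac cb].
split; first exact: le_trans ac.
by apply: le_lt_trans bY; rewrite lee_fin.
Qed.

Lemma lebesgue_measure_Ico0 (y : \bar R) : 0 <= y -> m (Ico0 y) = y.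
Proof.
case: y => [c| |]// c0.
  rewrite (_ : Ico0 _ = `[0%R, c[%classic); last first.
    by apply/seteqP; split => r /=; rewrite in_itv/= /Ico0/= lte_fin => /andP.
  rewrite /= lebesgue_measure_itv/= lte_fin; case: ltP => [|c0']; rewrite ?sube0//.
  by move: c0; rewrite lee_fin => c0; congr EFin; apply/eqP; rewrite eq_le c0 c0'.
rewrite (_ : Ico0 _ = `[0%R, +oo[%classic); last first.
  by apply/seteqP; split => r /=; rewrite in_itv/= /Ico0/= andbT ltry; [case|split].
by rewrite /= lebesgue_measure_itv/= ltry.
Qed.

(** Tonelli for the region below the graph of h, whose vertical sections are the
    intervals [0, h x[ and whose horizontal sections are the superlevel sets. *)
Lemma layer_cake (D : set R) (h : R -> \bar R) : measurable D ->
  measurable_fun D h -> (forall x, D x -> 0 <= h x) ->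
  \int[m]_(x in D) h x =
  \int[m]_(r in `[0%R, +oo[) m (D `&` [set x | r%:E < h x]).
Proof.
move=> mD mh h0; rewrite integral_mkcond.
set hD : R -> \bar R := h \_ D.
have mhD : measurable_fun setT hD by apply/(measurable_restrictT h).
have hD0 x : 0 <= hD x.
  by rewrite /hD patchE; case: ifPn => // /set_mem; exact: h0.
pose A := [set p : R * R | (0 <= p.2)%R /\ p.2%:E < hD p.1].
have mA : measurable A.
  rewrite (_ : A = (fun p : R * R => 0%R <= p.2)%R @^-1` [set true] `&`
     [set p | (p.2)%:E < hD p.1]); last first.
    by apply/seteqP; split => p /=.
  apply: measurableI.
    have : measurable_fun setT (fun p : R * R => 0%R <= p.2)%R.
      exact: measurable_fun_ler.
    by move=> /(_ measurableT [set true]); rewrite setTI; exact.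
  rewrite -[X in measurable X]setTI.
  apply: measurable_lte => //; first by apply/measurable_EFinP.
  exact: measurableT_comp measurable_fst.
transitivity (\int[m]_x \int[m]_r (\1_A (x, r))%:E).
  apply: eq_integral => x _.
  rewrite -[LHS]lebesgue_measure_Ico0//.
  have -> : Ico0 (hD x) = xsection A x.
    by apply/seteqP; split => r; rewrite /xsection /= inE.
  rewrite -[xsection A x]setIT -integral_indic//; last exact: measurable_xsection.
  apply: eq_integral => r _; rewrite !indicE; congr ((nat_of_bool _)%:R%:E).
  by rewrite mem_xsection.
transitivity (\int[m]_r \int[m]_x (\1_A (x, r))%:E).
  apply: (@fubini_tonelli _ _ _ _ _ m m (fun p : R * R => (\1_A p)%:E)) => //.
  exact/measurable_EFinP/measurable_indic.
rewrite [RHS]integral_mkcond; apply: eq_integral => r _.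
rewrite patchE; case: ifPn => [/set_mem/=|/negP];
  rewrite ?in_setE/= in_itv/= andbT => r0.
  pose Dr := D `&` [set x | r%:E < h x].
  rewrite (_ : (fun x => _) = (fun x => (\1_Dr x)%:E)).
    by rewrite integral_indic// ?setIT//; exact: emeasurable_fun_o_infty.
  apply/funext => x; rewrite !indicE; congr ((nat_of_bool _)%:R%:E).
  apply/idP/idP; rewrite !inE /A/= /hD patchE.
    move=> [_]; case: ifPn => [/set_mem //|_].
    by rewrite lte_fin ltNge r0.
  by move=> [Dx rh]; rewrite mem_set.
apply: integral0_eq => x _; rewrite indicE memNset//= => -[r0' _].
by apply: r0.
Qed.

End LayerCake.

(** * Rearrangement, excess and submajorization *)

Section Rearrangement.
Context {R : realType} (alpha : \bar R).
Local Notation m := (@lebesgue_measure R).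
Local Notation D := (Ico0 alpha).
Implicit Types (f g : R -> R[i]) (l r s t : R).

Lemma measurable_normc f : L0 alpha f ->
  measurable_fun D (fun x => normc (f x)).
Proof.
move=> [mr mi].
rewrite (_ : (fun x => _) = (fun x => Num.sqrt (complex.Re (f x) ^+ 2 + complex.Im (f x) ^+ 2)))%R; last first.
  by apply/funext => x; case: (f x).
have ms : measurable_fun setT (@Num.sqrt R).
  by apply: continuous_measurable_fun; exact: sqrt_continuous.
apply: (measurableT_comp ms).
by apply: measurable_funD; exact: measurable_funX.
Qed.

Lemma measurable_superlevel f s : L0 alpha f ->
  measurable (D `&` [set x | (s < normc (f x))%R]).
Proof.
move=> /measurable_normc mf.
rewrite (_ : mkset _ = (fun x => normc (f x)) @^-1` `]s, +oo[%classic); last first.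
  by apply/seteqP; split => x /=; rewrite in_itv/= andbT.
apply: mf => //; exact: measurable_Ico0.
Qed.

Lemma distribution_ge0 f s : 0 <= distribution_fun alpha f s.
Proof. exact: measure_ge0. Qed.

Lemma le_distribution f s t : L0 alpha f -> (s <= t)%R ->
  distribution_fun alpha f t <= distribution_fun alpha f s.
Proof.
move=> f0 st; apply: le_measure; rewrite ?inE; [exact: measurable_superlevel..|].
by move=> x [Dx /= tf]; split => //=; exact: le_lt_trans tf.
Qed.

(** Continuity of the measure from below, along superlevel sets of decreasing
    levels. *)
Lemma distribution_lsc f s (y : \bar R) : L0 alpha f ->
  y < distribution_fun alpha f s ->
  exists2 s', (s < s')%R & y < distribution_fun alpha f s'.
Proof.
move=> f0 ys; apply: contrapT => H.
suff : distribution_fun alpha f s <= y by rewrite leNgt ys.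
pose F (n : nat) := D `&` [set x | (s + n.+1%:R^-1 < normc (f x))%R].
have mF n : measurable (F n) by exact: measurable_superlevel.
have UF : \bigcup_n F n = D `&` [set x | (s < normc (f x))%R].
  apply/seteqP; split => x /=.
    by case=> n _ [Dx /=] sf; split => //=; apply: lt_trans sf; rewrite ltrDl.
  move=> [Dx sf]; have := sf; rewrite -subr_gt0 => /ltr_add_invr [n].
  rewrite add0r => nf; exists n => //; split => //=.
  by rewrite addrC -ltrBrDr.
have ndF : nondecreasing_seq F.
  move=> i j ij; apply/subsetPset => x [Dx /= sf]; split => //=.
  apply: le_lt_trans sf; rewrite lerD2l lef_pV2 ?posrE// ler_nat ltnS//.
have := @nondecreasing_cvg_mu _ _ _ m _ mF (bigcup_measurable (fun n _ => mF n)) ndF.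
rewrite UF => cF; rewrite /distribution_fun -(cvg_lim _ cF)//.
apply: lime_le; first by apply/cvg_ex; eexists; exact: cF.
apply: nearW => n /=; rewrite leNgt; apply/negP => yF; apply: H.
by exists (s + n.+1%:R^-1)%R => //; rewrite ltrDl.
Qed.

Lemma rearr_ge0 f t : 0 <= rearr alpha f t.
Proof. by apply: le_ereal_inf_tmp => _ [s [/ltW s0 _]] <-; rewrite lee_fin. Qed.

Lemma rearr_nonincreasing f s t : (s <= t)%R ->
  rearr alpha f t <= rearr alpha f s.
Proof.
move=> st; apply: le_ereal_inf => _ [r [r0 rs]] <-; exists r => //; split => //.
by apply: le_trans rs _; rewrite lee_fin.
Qed.

(** The rearrangement and the distribution function are generalized inverses of
    each other; the strict inequalities match because distribution_fun is right
    continuous. *)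
Lemma lt_rearr f s t : L0 alpha f -> (0 <= s)%R ->
  (s%:E < rearr alpha f t) = (t%:E < distribution_fun alpha f s).
Proof.
move=> f0 s0; apply/idP/idP.
  apply: contraTT; rewrite -!leNgt => ds.
  apply/lee_addgt0Pr => e e0; apply: ereal_inf_lbound.
  exists (s + e)%R => //; split; first by rewrite ltr_wpDl.
  by apply: le_trans ds; apply: le_distribution => //; rewrite lerDl ltW.
move=> /(distribution_lsc f0)[s' ss' ts']; apply: lt_le_trans (_ : s'%:E <= _).
  by rewrite lte_fin.
apply: le_ereal_inf_tmp => _ [r [r0 rt]] <-; rewrite lee_fin leNgt.
apply/negP => /ltW rs'; move: ts'; rewrite ltNge => /negP; apply.
by apply: le_trans rt; exact: le_distribution.
Qed.

Lemma measurable_rearr f : measurable_fun setT (rearr alpha f).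
Proof.
move=> _; apply: (measurability _ (ErealGenOInfty.measurableE R)) => //.
move=> /= _ [_ [x ->] <-]; rewrite setTI.
apply: is_interval_measurable => a b /=; rewrite !in_itv/= !andbT.
move=> _ xb c /andP[_ cb]; rewrite in_itv/= andbT.
by apply: lt_le_trans xb _; exact: rearr_nonincreasing.
Qed.

(** The supremum of int_rearr alpha f t - t l over t, that is, up to signs, a
    Legendre transform; the duality is exploited in submajorizedP. *)
Definition excess f (l : R) : \bar R :=
  \int[m]_(x in D) (Num.max (normc (f x) - l) 0)%:E.

Lemma excess_ge0 f l : 0 <= excess f l.
Proof. by apply: integral_ge0 => x _; rewrite lee_fin le_max lexx orbT. Qed.

Lemma measurable_excess f l : L0 alpha f ->
  measurable_fun D (fun x => (Num.max (normc (f x) - l) 0)%:E).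
Proof.
move=> /measurable_normc mf; apply/measurable_EFinP.
by apply: measurable_maxr => //; apply: measurable_funB.
Qed.

Lemma excess_layer f l : L0 alpha f -> (0 <= l)%R ->
  excess f l = \int[m]_(r in `[0%R, +oo[) distribution_fun alpha f (l + r).
Proof.
move=> f0 l0; rewrite /excess layer_cake; last 3 first.
- exact: measurable_Ico0.
- exact: measurable_excess.
- by move=> x _; rewrite lee_fin le_max lexx orbT.
apply: eq_integral => r; rewrite inE/= in_itv/= andbT => r0.
have r0' : (r < 0)%R = false by rewrite ltNge r0.
rewrite /distribution_fun; congr (m (_ `&` _)); apply/seteqP; split => x /=;
  by rewrite lte_fin lt_max r0' orbF ltrBrDl.
Qed.

(** By lt_rearr, |f| on [0, alpha) and rearr alpha f on [0, +oo[ have superlevel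
    sets of the same measure, so the layer cake formula gives both integrals the
    same value. *)
Lemma excess_rearr f l : L0 alpha f -> (0 <= l)%R ->
  \int[m]_(t in `[0%R, +oo[) maxe (rearr alpha f t - l%:E) 0 = excess f l.
Proof.
move=> f0 l0; rewrite excess_layer// layer_cake//; last 2 first.
- apply: measurable_maxe => //; apply: emeasurable_funB => //.
  by apply: measurable_funTS; exact: measurable_rearr.
- by move=> x _; rewrite le_max lexx orbT.
apply: eq_integral => r; rewrite inE/= in_itv/= andbT => r0.
have r0' : (r < 0)%R = false by rewrite ltNge r0.
rewrite -[RHS]lebesgue_measure_Ico0 ?measure_ge0//; congr (m _).
have E t : (r%:E < maxe (rearr alpha f t - l%:E) 0) =
   (t%:E < distribution_fun alpha f (l + r)).
  rewrite lt_max [X in _ || X]lte_fin r0' orbF lteBrDl// -EFinD.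
  by rewrite lt_rearr// addr_ge0.
by apply/seteqP; split => t /=; rewrite E in_itv/= andbT.
Qed.

(** The part of the integral in excess_rearr that comes from [0, t]; its
    difference with int_rearr is controlled by truncating rearr at the level l. *)
Definition excess_upto f l (t : R) : \bar R :=
  \int[m]_(s in `[0%R, t]) maxe (rearr alpha f s - l%:E) 0.

Lemma measurable_rearr_excess A f l :
  measurable_fun A (fun s => maxe (rearr alpha f s - l%:E) 0).
Proof.
apply: measurable_funTS; apply: measurable_maxe => //.
by apply: emeasurable_funB => //; exact: measurable_rearr.
Qed.

Lemma rearr_excess_ge0 f l s : 0 <= maxe (rearr alpha f s - l%:E) 0.
Proof. by rewrite le_max lexx orbT. Qed.

Lemma int_rearr_split f l t : (0 <= t)%R -> (0 <= l)%R ->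
  \int[m]_(s in `[0%R, t]) (l%:E + maxe (rearr alpha f s - l%:E) 0) =
  (t * l)%:E + excess_upto f l t.
Proof.
move=> t0 l0; rewrite ge0_integralD//; last 2 first.
- by move=> x _; exact: rearr_excess_ge0.
- exact: measurable_rearr_excess.
congr (_ + _); rewrite integral_cst//= lebesgue_measure_itv/= lte_fin.
case: ltP => [t0'|t0']; first by rewrite oppr0 addr0 -EFinM mulrC.
by rewrite (_ : t = 0%R) ?mul0r ?mule0//; apply/eqP; rewrite eq_le t0 t0'.
Qed.

Lemma int_rearr_le f l t : (0 <= t)%R -> (0 <= l)%R ->
  int_rearr alpha f t <= (t * l)%:E + excess_upto f l t.
Proof.
move=> t0 l0; rewrite -int_rearr_split//; apply: ge0_le_integral => //.
- by move=> x _; exact: rearr_ge0.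
- by apply: measurable_funTS; exact: measurable_rearr.
- by apply: emeasurable_funD => //; exact: measurable_rearr_excess.
- by move=> s _; rewrite -leeBlDl// le_max lexx.
Qed.

Lemma int_rearr_eq f l t : (0 <= t)%R -> (0 <= l)%R ->
  (forall s, (0 <= s < t)%R -> l%:E <= rearr alpha f s) ->
  int_rearr alpha f t = (t * l)%:E + excess_upto f l t.
Proof.
move=> t0 l0 H; rewrite -int_rearr_split// /int_rearr.
rewrite -integral_itv_bndo_bndc; last first.
  by apply: measurable_funTS; exact: measurable_rearr.
rewrite -[RHS]integral_itv_bndo_bndc; last first.
  by apply: emeasurable_funD => //; exact: measurable_rearr_excess.
apply: eq_integral => s; rewrite inE/= in_itv/= => /H ls.
rewrite max_l; first by rewrite addeC EFinN subeK.
by rewrite EFinN leeBrDr// add0e.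
Qed.

Lemma excess_upto_le f l t : L0 alpha f -> (0 <= l)%R ->
  excess_upto f l t <= excess f l.
Proof.
move=> f0 l0; rewrite -excess_rearr//; apply: ge0_subset_integral => //.
- exact: measurable_rearr_excess.
- by move=> s _; exact: rearr_excess_ge0.
- by move=> s /=; rewrite !in_itv/= andbT => /andP[].
Qed.

Lemma excess_upto_eq f l t : L0 alpha f -> (0 <= l)%R -> (0 <= t)%R ->
  (forall s, (t < s)%R -> rearr alpha f s <= l%:E) ->
  excess_upto f l t = excess f l.
Proof.
move=> f0 l0 t0 H; rewrite -excess_rearr// /excess_upto.
rewrite integral_mkcond [RHS]integral_mkcond; apply: eq_integral => s _.
rewrite !patchE; have [st|ts] := leP s t.
  by congr (if _ then _ else _); apply/idP/idP; rewrite !inE/= !in_itv/= ?andbT st ?andbT.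
rewrite memNset; last by rewrite /= in_itv/= (leNgt s) ts andbF.
case: ifPn => // _; apply/esym/max_r.
by rewrite leeBlDr// add0e H.
Qed.

(** One half of the duality: truncate rearr at the level l. *)
Lemma int_rearr_le_excess f l t : L0 alpha f -> (0 <= t)%R -> (0 <= l)%R ->
  int_rearr alpha f t <= (t * l)%:E + excess f l.
Proof.
move=> f0 t0 l0; apply: (le_trans (int_rearr_le f t0 l0)).
by rewrite leeD2lE//; exact: excess_upto_le.
Qed.

(** The other half: at l = rearr f t the truncation is exact, since rearr is at
    least l before t and at most l after t. *)
Lemma int_rearr_eq_excess f l t : L0 alpha f -> (0 <= t)%R ->
  rearr alpha f t = l%:E -> int_rearr alpha f t = (t * l)%:E + excess f l.
Proof.
move=> f0 t0 ftl; have l0 : (0 <= l)%R by rewrite -lee_fin -ftl rearr_ge0.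
rewrite (@int_rearr_eq f l)//; first congr (_ + _).
  by apply: excess_upto_eq => // s ts; rewrite -ftl rearr_nonincreasing// ltW.
by move=> s /andP[_ st]; rewrite -ftl rearr_nonincreasing// ltW.
Qed.

Lemma int_rearr0 f : int_rearr alpha f 0 = 0.
Proof. by rewrite /int_rearr set_itv1 integral_set1. Qed.

(** Both order relations compare dual functions. The integral of the rearrangement
    is recovered from the excess at l = rearr g t; conversely excess f l is reached by
    int_rearr f t - t l at t = distribution_fun f l, or as t tends to infinity if
    that value is infinite. *)
Lemma submajorizedP f g : L0 alpha f -> L0 alpha g ->
  (forall t, (0 < t)%R -> rearr alpha g t < +oo) ->
  submajorized alpha f g <->
  (forall l, (0 <= l)%R -> excess f l <= excess g l).
Proof.
move=> f0 g0 goo.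
have gfin t : (0 < t)%R -> exists2 c, (0 <= c)%R & rearr alpha g t = c%:E.
  move=> t0; exists (fine (rearr alpha g t)); first by rewrite fine_ge0 ?rearr_ge0.
  by rewrite fineK// ge0_fin_numE ?rearr_ge0// goo.
split => [fg l l0|fg t t0].
  have {}fg t : (0 <= t)%R -> int_rearr alpha f t <= int_rearr alpha g t.
    by rewrite le_eqVlt => /predU1P[<-|/fg//]; rewrite !int_rearr0.
  have H t : (0 <= t)%R -> t%:E <= distribution_fun alpha f l ->
      excess_upto f l t <= excess g l.
    move=> t0 td; rewrite -(@leeD2lE _ (t * l)%:E)// -int_rearr_eq//.
      exact: le_trans (fg _ t0) (int_rearr_le_excess g0 t0 l0).
    move=> s /andP[_ st]; apply: ltW; rewrite lt_rearr//.
    by apply: lt_le_trans td; rewrite lte_fin.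
  case E : (distribution_fun alpha f l) => [d| |].
  - have d0 : (0 <= d)%R by rewrite -lee_fin -E measure_ge0.
    rewrite -(@excess_upto_eq f l d)//; first by apply: H => //; rewrite E.
    move=> s ds; rewrite leNgt lt_rearr// E lte_fin -leNgt.
    exact: ltW.
  - rewrite -excess_rearr//.
    pose F (n : nat) : set R := `[0%R, n%:R[%classic.
    have ndF : nondecreasing_seq F.
      move=> i j ij; apply/subsetPset => x; rewrite /F /= !in_itv/= => /andP[-> /=].
      by move=> /lt_le_trans; apply; rewrite ler_nat.
    have := @ge0_nondecreasing_set_cvg_integral _ (measurableTypeR R) R F
      (fun s => maxe (rearr alpha f s - l%:E) 0) m ndF
      (fun n => measurable_itv _) (fun n => @measurable_rearr_excess (F n) f l)
      (fun n s _ => rearr_excess_ge0 f l s).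
    rewrite -itvbndyEbigcup => cF; rewrite -(cvg_lim _ cF)//.
    apply: lime_le; first by apply/cvg_ex; eexists; exact: cF.
    apply: nearW => n; rewrite /F integral_itv_bndo_bndc; last first.
      exact: measurable_rearr_excess.
    by apply: H; rewrite ?E ?leey.
  - by have := distribution_ge0 f l; rewrite E.
have [c c0 E] := gfin t t0; rewrite (int_rearr_eq_excess g0 (ltW t0) E).
apply: le_trans (int_rearr_le_excess f0 (ltW t0) c0) _.
by rewrite leeD2lE//; exact: (fg c c0).
Qed.

End Rearrangement.

(** * The orbit as a convex set and the unit sphere *)

Section Complex.
Context {R : realType}.
Implicit Types (z w : R[i]) (c : R).

Lemma normc_ge0 z : (0 <= normc z)%R.
Proof. by case: z => a b; exact: sqrtr_ge0. Qed.

Lemma normc_real c : normc (c%:C)%C = `|c|%R.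
Proof. by rewrite /normc/= expr0n/= addr0 sqrtr_sqr. Qed.

Lemma normc_scale c z : normc ((c%:C)%C * z)%R = (`|c| * normc z)%R.
Proof. by rewrite normcM normc_real. Qed.

Lemma Re_scale c z : complex.Re ((c%:C)%C * z)%R = (c * complex.Re z)%R.
Proof. by case: z => a b /=; rewrite mul0r subr0. Qed.

Lemma Im_scale c z : complex.Im ((c%:C)%C * z)%R = (c * complex.Im z)%R.
Proof. by case: z => a b /=; rewrite mul0r addr0. Qed.

Lemma ReD z w : complex.Re (z + w)%R = (complex.Re z + complex.Re w)%R.
Proof. by case: z; case: w. Qed.

Lemma ImD z w : complex.Im (z + w)%R = (complex.Im z + complex.Im w)%R.
Proof. by case: z; case: w. Qed.

End Complex.

Section Orbit.
Context {R : realType} (alpha : \bar R).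
Local Notation m := (@lebesgue_measure R).
Local Notation D := (Ico0 alpha).
Implicit Types (f g h : R -> R[i]) (l r s t c : R).

Lemma L0_scale (p : R -> R) f : measurable_fun D p -> L0 alpha f ->
  L0 alpha (fun x => (p x)%:C%C * f x)%R.
Proof.
move=> mp [mr mi]; split; rewrite /=.
  under eq_fun do rewrite Re_scale.
  exact: measurable_funM.
under eq_fun do rewrite Im_scale.
exact: measurable_funM.
Qed.

Lemma L0_add f g : L0 alpha f -> L0 alpha g -> L0 alpha (fun x => f x + g x)%R.
Proof.
move=> [mr mi] [mr' mi']; split; rewrite /=.
  under eq_fun do rewrite ReD.
  exact: measurable_funD.
under eq_fun do rewrite ImD.
exact: measurable_funD.
Qed.

Lemma L0_cst (z : R[i]) : L0 alpha (fun=> z).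
Proof. by split; exact: measurable_cst. Qed.

Lemma L0_sum n (x : 'I_n -> R -> R[i]) : (forall i, L0 alpha (x i)) ->
  L0 alpha (fun t => \sum_(i < n) x i t)%R.
Proof.
elim: n x => [|n IH] x x0.
  under eq_fun do rewrite big_ord0.
  exact: L0_cst.
under eq_fun do rewrite big_ord_recr/=.
by apply: L0_add => //; exact: IH.
Qed.

Lemma le_excess f l l' : L0 alpha f -> (l <= l')%R ->
  excess alpha f l' <= excess alpha f l.
Proof.
move=> f0 ll'; apply: ge0_le_integral.
- exact: measurable_Ico0.
- by move=> x _; rewrite lee_fin le_max lexx orbT.
- exact: measurable_excess.
- exact: measurable_excess.
- by move=> x _; rewrite lee_fin; apply: le_max2 => //; rewrite lerD2l lerN2.
Qed.

(** Split f at the level 2 l: where |f| > 2 l, |f| is at most twice |f| - l. *)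
Lemma excess_fin_L1_plus_Linfty f l : L0 alpha f -> (0 <= l)%R ->
  excess alpha f l < +oo -> L1_plus_Linfty alpha f.
Proof.
move=> f0 l0 fl; split => //.
pose A := D `&` [set x | (2 * l < normc (f x))%R].
have mA : measurable A by exact: measurable_superlevel.
have A0 : measurable_fun D (\1_A : R -> R) by exact: measurable_indic.
have A1 : measurable_fun D (fun x => 1 - \1_A x : R)%R by exact: measurable_funB.
have u0 := L0_scale A0 f0; have v0 := L0_scale A1 f0.
exists (fun x => (\1_A x)%:C%C * f x)%R, (fun x => (1 - \1_A x)%:C%C * f x)%R.
split.
- split => //; apply: le_lt_trans (_ : _ <= 2%:E * excess alpha f l) _; last first.
    by rewrite lte_mul_pinfty.
  rewrite -ge0_integralZl_EFin//; last 3 first.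
  + exact: measurable_Ico0.
  + by move=> x _; rewrite lee_fin le_max lexx orbT.
  + exact: measurable_excess.
  apply: ge0_le_integral.
  + exact: measurable_Ico0.
  + by move=> x _; rewrite lee_fin normc_ge0.
  + by apply/measurable_EFinP; exact: measurable_normc.
  + by apply: emeasurable_funM => //; exact: measurable_excess.
  + move=> x Dx; rewrite -EFinM lee_fin normc_scale indicE.
    have [/set_mem[_ /= xA]|_] := boolP (x \in A); last first.
      by rewrite normr0 mul0r mulr_ge0// le_max lexx orbT.
    rewrite normr1 mul1r.
    have : (normc (f x) - l <= Num.max (normc (f x) - l) 0)%R by rewrite le_max lexx.
    lra.
- split => //; exists (2 * l)%R; apply: aeW => x Dx.
  rewrite normc_scale indicE; have [_|/negP xA] := boolP (x \in A).
    by rewrite subrr normr0 mul0r mulr_ge0.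
  rewrite subr0 normr1 mul1r leNgt; apply/negP => fx; apply: xA.
  by rewrite inE.
- apply: aeW => x Dx; rewrite indicE.
  by case: (x \in A); rewrite ?subrr ?subr0 mul1r mul0r ?addr0 ?add0r.
Qed.

(** If f = u + v with |v| <= M, then |f| - M <= |u|. *)
Lemma L1_plus_Linfty_excess_fin f : L1_plus_Linfty alpha f ->
  exists2 l, (0 <= l)%R & excess alpha f l < +oo.
Proof.
move=> [f0 [u [v [[u0 ui] [v0 [M vM]] fuv]]]].
exists (Num.max M 0)%R; first by rewrite le_max lexx orbT.
apply: le_lt_trans ui; apply: ae_ge0_le_integral.
- exact: measurable_Ico0.
- by move=> x _; rewrite lee_fin le_max lexx orbT.
- exact: measurable_excess.
- by move=> x _; rewrite lee_fin normc_ge0.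
- by apply/measurable_EFinP; exact: measurable_normc.
apply: (ae_and vM fuv) => x {}vM {}fuv Dx; rewrite (fuv Dx) lee_fin.
rewrite ge_max normc_ge0 andbT; have := le_normcD (u x) (v x).
have := vM Dx; have : (M <= Num.max M 0)%R by rewrite le_max lexx.
lra.
Qed.

(** Chebyshev bound, since rearr is at least L on [0, t]. *)
Lemma rearr_int_rearr f t L : (0 <= t)%R -> (0 <= L)%R ->
  L%:E <= rearr alpha f t -> (t * L)%:E <= int_rearr alpha f t.
Proof.
move=> t0 L0 Lf; rewrite (@int_rearr_eq _ _ _ L)//.
  by rewrite leeDl// integral_ge0// => s _; exact: rearr_excess_ge0.
by move=> s /andP[_ st]; apply: (le_trans Lf); rewrite rearr_nonincreasing// ltW.
Qed.

Lemma int_rearr_fin f t : L1_plus_Linfty alpha f -> (0 <= t)%R ->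
  int_rearr alpha f t < +oo.
Proof.
move=> fL t0; have [l l0 fl] := L1_plus_Linfty_excess_fin fL.
apply: le_lt_trans (int_rearr_le_excess _ t0 l0) _; first by case: fL.
by rewrite lte_add_pinfty// ltry.
Qed.

Lemma int_rearr_ge0 f t : 0 <= int_rearr alpha f t.
Proof. by apply: integral_ge0 => s _; exact: rearr_ge0. Qed.

Lemma rearr_fin f t : L1_plus_Linfty alpha f -> (0 < t)%R ->
  rearr alpha f t < +oo.
Proof.
move=> fL t0; rewrite ltey; apply/eqP => ft.
have := int_rearr_fin fL (ltW t0); have := int_rearr_ge0 f t.
case E : (int_rearr alpha f t) => [c| |]// c0 _; rewrite lee_fin in c0.
have := @rearr_int_rearr f t ((c + 1) / t)%R (ltW t0).
have ct : (0 <= (c + 1) / t)%R by rewrite divr_ge0 ?addr_ge0// ltW.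
rewrite ft leey E => /(_ ct isT).
by rewrite mulrC divfK ?gt_eqF// lee_fin gerDl ler10.
Qed.

Lemma rearr_fin_num f t : L1_plus_Linfty alpha f -> (0 < t)%R ->
  rearr alpha f t \is a fin_num.
Proof. by move=> fL t0; rewrite ge0_fin_numE ?rearr_ge0// rearr_fin. Qed.

(** In this form the orbit is visibly convex, the excess being convex in h. *)
Lemma OmegaP g h : L1_plus_Linfty alpha g ->
  Omega alpha g h <->
  L0 alpha h /\ forall l, (0 <= l)%R -> excess alpha h l <= excess alpha g l.
Proof.
move=> gL; have g0 : L0 alpha g by case: gL.
have gt t : (0 < t)%R -> rearr alpha g t < +oo by exact: rearr_fin.
split=> [[hL hg]|[h0 hg]].
  by have h0 : L0 alpha h by [case: hL]; split => //; apply/submajorizedP.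
split; last exact/submajorizedP.
have [l l0 gl] := L1_plus_Linfty_excess_fin gL.
by apply: (excess_fin_L1_plus_Linfty h0 l0); exact: le_lt_trans (hg _ l0) gl.
Qed.

Lemma rearr_scale f c t : L0 alpha f -> (0 < c)%R ->
  rearr alpha (fun x => c%:C%C * f x)%R t = c%:E * rearr alpha f t.
Proof.
move=> f0 c0; have cf0 : L0 alpha (fun x => c%:C%C * f x)%R by exact: L0_scale.
apply: eq_lte_EFin.
- exact: rearr_ge0.
- by rewrite mule_ge0 ?rearr_ge0// lee_fin ltW.
move=> s s0; rewrite lt_rearr// -lte_pdivrMl// -EFinM lt_rearr//; last first.
  by rewrite mulr_ge0// invr_ge0 ltW.
congr (_ < _); congr (m (_ `&` _)); apply/seteqP; split => x /=;
  by rewrite normc_scale gtr0_norm// [(c^-1 * s)%R]mulrC ltr_pdivrMr// mulrC.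
Qed.

Lemma int_rearr_scale f c t : L0 alpha f -> (0 < c)%R ->
  int_rearr alpha (fun x => c%:C%C * f x)%R t = c%:E * int_rearr alpha f t.
Proof.
move=> f0 c0; rewrite /int_rearr; under eq_integral do rewrite rearr_scale//.
rewrite ge0_integralZl_EFin//; last exact: ltW.
- by move=> x _; exact: rearr_ge0.
- by apply: measurable_funTS; exact: measurable_rearr.
Qed.

Lemma distribution0_gt0 g : L0 alpha g -> ~ aeq alpha g (fun=> 0%R) ->
  0 < distribution_fun alpha g 0.
Proof.
move=> g0 gn0; rewrite lt0e distribution_ge0 andbT; apply/eqP => d0; apply: gn0.
exists (D `&` [set x | (0 < normc (g x))%R]); split => //.
  exact: measurable_superlevel.
move=> x /= /not_implyP[Dx gx]; split => //=; rewrite lt_def normc_ge0 andbT.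
by apply/negP => /eqP /eq0_normc.
Qed.

(** Together with int_rearr_fin, this makes the quotients in the Marcinkiewicz
    norm genuine quotients of real numbers. *)
Lemma int_rearr_gt0 g t : L0 alpha g -> ~ aeq alpha g (fun=> 0%R) ->
  (0 < t)%R -> 0 < int_rearr alpha g t.
Proof.
move=> g0 /(distribution0_gt0 g0) d0 t0.
have [s s0 sd] : exists2 s, (0 < s <= t)%R & s%:E < distribution_fun alpha g 0.
  move: d0; case: (distribution_fun alpha g 0) => [d| |]// d0.
  - rewrite lte_fin in d0; exists (Num.min t (d / 2))%R.
      by rewrite lt_min t0 divr_gt0//= ge_min lexx.
    by rewrite lte_fin gt_min ltr_pdivrMr// orbC mulr2n mulrDr mulr1 ltrDl d0.
  - by exists t; rewrite ?t0 ?lexx ?ltry.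
have [L L0' Ld] := distribution_lsc g0 sd.
have /andP[s0' st] := s0.
apply: (@lt_le_trans _ _ (s * L)%:E); first by rewrite lte_fin mulr_gt0.
apply: (@le_trans _ _ (int_rearr alpha g s)).
  apply: rearr_int_rearr; [exact: ltW|exact: ltW|].
  by apply: ltW; rewrite lt_rearr// ltW.
apply: ge0_subset_integral => //.
- by apply: measurable_funTS; exact: measurable_rearr.
- by move=> x _; exact: rearr_ge0.
- by apply: subset_itvl; rewrite bnd_simp.
Qed.

Lemma marcinkiewicz_norm_le g h r : L1_plus_Linfty alpha g ->
  ~ aeq alpha g (fun=> 0%R) -> (0 <= r)%R ->
  marcinkiewicz_norm alpha g h <= r%:E <->
  forall t, (0 < t)%R -> int_rearr alpha h t <= r%:E * int_rearr alpha g t.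
Proof.
move=> gL gn0 r0; have g0 : L0 alpha g by case: gL.
have H t : (0 < t)%R -> (int_rearr alpha h t / int_rearr alpha g t <= r%:E) =
    (int_rearr alpha h t <= r%:E * int_rearr alpha g t).
  move=> t0; have := int_rearr_gt0 g0 gn0 t0.
  have := int_rearr_fin gL (ltW t0).
  case: (int_rearr alpha g t) => [c| |]// _ c0; rewrite lte_fin in c0.
  by rewrite inver gt_eqF// lee_pdivrMr.
split=> [/ereal_supP h1 t t0|h1].
  by rewrite -H//; apply: h1; exists t.
by apply/ereal_supP => _ [t t0 <-]; rewrite H// h1.
Qed.

(** The norm is the gauge of the orbit, by homogeneity of the rearrangement. This
    lets the rest of the proof forget the norm and use only the convex set. *)
Lemma sphereP g h : L1_plus_Linfty alpha g -> ~ aeq alpha g (fun=> 0%R) ->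
  marcinkiewicz_sphere alpha g h <->
  Omega alpha g h /\ forall r, (0 < r < 1)%R ->
    ~ Omega alpha g (fun x => (r^-1)%:C%C * h x)%R.
Proof.
move=> gL gn0; have g0 : L0 alpha g by case: gL.
have normP r : (0 < r)%R -> L0 alpha h ->
    Omega alpha g (fun x => (r^-1)%:C%C * h x)%R <->
    marcinkiewicz_norm alpha g h <= r%:E.
  move=> r0 h0.
  have rh0 : L0 alpha (fun x => (r^-1)%:C%C * h x)%R by exact: L0_scale.
  rewrite (marcinkiewicz_norm_le _ gL gn0 (ltW r0)).
  have E t : (int_rearr alpha (fun x => (r^-1)%:C%C * h x)%R t <= int_rearr alpha g t) =
     (int_rearr alpha h t <= r%:E * int_rearr alpha g t).
    by rewrite int_rearr_scale ?invr_gt0// lee_pdivrMl.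
  split=> [[_ hg] t t0|hg]; first by rewrite -E hg.
  have {}hg : submajorized alpha (fun x => (r^-1)%:C%C * h x)%R g.
    by move=> t t0; rewrite E hg.
  apply/(OmegaP _ gL); split => //; apply/submajorizedP => // t; exact: rearr_fin.
have one : (fun x => (1^-1)%:C%C * h x)%R = h.
  by apply/funext => x; rewrite invr1 mul1r.
split=> [[[h0 _] h1]|[hO hr]].
  split; first by rewrite -one; apply/normP => //; rewrite h1.
  move=> r /andP[r0 r1] /(normP r r0 h0); rewrite h1 lee_fin leNgt r1//.
have h0 : L0 alpha h by case: hO => -[].
have h1 : marcinkiewicz_norm alpha g h <= 1.
  by have [+ _] := normP 1%R ltr01 h0; rewrite one; apply.
split; first by split => //; apply: le_lt_trans h1 _; exact: ltry.
apply/eqP; rewrite eq_le h1/= leNgt; apply/negP => hlt.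
have [r /andP[r0 r1] hr'] : exists2 r, (0 < r < 1)%R & marcinkiewicz_norm alpha g h <= r%:E.
  move: hlt; case: (marcinkiewicz_norm alpha g h) => [c| |]//.
    rewrite lte_fin => c1; exists (Num.max c (1 / 2))%R.
      by rewrite lt_max gt_max c1; apply/andP; split; [apply/orP; right|]; lra.
    by rewrite lee_fin le_max lexx.
  by move=> _; exists (1 / 2)%R; rewrite ?leNye//; lra.
by apply: (hr r); [rewrite r0|apply/normP].
Qed.

End Orbit.

(** * Extreme points are k-extreme *)

Section ComplexConvexity.
Context {R : realType}.
Implicit Types (y z w : R[i]) (l : R).

Lemma real_complex_natV n : ((n.+1%:R)^-1 : R[i])%R = ((n.+1%:R)^-1)%:C%C.
Proof. by rewrite fmorphV rmorph_nat. Qed.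

Lemma normc_sqr z : (normc z ^+ 2 = complex.Re z ^+ 2 + complex.Im z ^+ 2)%R.
Proof. by case: z => a b; rewrite /normc sqr_sqrtr// addr_ge0 ?sqr_ge0. Qed.

(** The parallelogram identity: l (1 - l) |y - z|^2 is
    l |y|^2 + (1 - l) |z|^2 - |w|^2, which is at most 0 here. *)
Lemma normc_strict_convex y z w l : (0 < l < 1)%R ->
  (w = l%:C%C * y + (1 - l)%:C%C * z)%R ->
  (normc y <= normc w)%R -> (normc z <= normc w)%R -> y = w /\ z = w.
Proof.
move=> /andP[l0 l1] -> yw zw.
have sq (a b : R[i]) : (normc a <= normc b)%R -> (normc a ^+ 2 <= normc b ^+ 2)%R.
  by move=> ab; rewrite ler_sqr ?nnegrE ?normc_ge0.
move: (sq _ _ yw) (sq _ _ zw) => {yw zw sq}; rewrite !normc_sqr !ReD !ImD !Re_scale !Im_scale.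
case: y => a b; case: z => c d /= H1 H2.
have H : (l * (1 - l) * ((a - c) ^+ 2 + (b - d) ^+ 2) <= 0)%R.
  have := ler_wpM2l (ltW l0) H1.
  have l1' : (0 <= 1 - l)%R by rewrite subr_ge0 ltW.
  have := ler_wpM2l l1' H2; nra.
have ll : (0 < l * (1 - l))%R by rewrite mulr_gt0// subr_gt0.
rewrite pmulr_rle0// in H.
have /andP[ac bd] : ((a - c) ^+ 2 == 0)%R && ((b - d) ^+ 2 == 0)%R.
  by rewrite -paddr_eq0 ?sqr_ge0// eq_le H addr_ge0// sqr_ge0.
move: ac bd; rewrite !sqrf_eq0 !subr_eq0 => /eqP -> /eqP ->.
have E : (l%:C%C * (c +i* d)%C + (1 - l)%:C%C * (c +i* d)%C = (c +i* d)%C :> R[i])%R.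
  by rewrite -mulrDl -rmorphD/= addrC subrK mul1r.
by rewrite E.
Qed.

(** An average of points of a convex set is a convex combination of any one of
    them with the average of the others. *)
Lemma avg_isolate k (x : 'I_k.+2 -> R[i]) i :
  ((k.+2%:R)^-1 * \sum_j x j = ((k.+2%:R)^-1)%:C%C * x i +
   (1 - (k.+2%:R)^-1)%:C%C * ((k.+1%:R)^-1 * \sum_(j < k.+1) x (lift i j)))%R.
Proof.
rewrite (bigD1_ord i)//= mulrDr real_complex_natV; congr (_ + _)%R.
rewrite mulrA; congr (_ * _)%R; rewrite real_complex_natV -rmorphM; congr (_%:C)%C.
have k1 : (k.+1%:R : R)%R != 0%R by rewrite pnatr_eq0.
have k2 : (k.+2%:R : R)%R != 0%R by rewrite pnatr_eq0.
apply: (mulfI k2); rewrite mulrA mulrBr mulr1 mulfV// -[in RHS](natr1 k.+1).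
by rewrite addrK mulfV.
Qed.

End ComplexConvexity.

Section Convexity.
Context {R : realType} (alpha : \bar R).
Local Notation m := (@lebesgue_measure R).
Local Notation D := (Ico0 alpha).
Implicit Types (f g h y z : R -> R[i]) (a b c l r s t : R).

(** Convexity and monotonicity of s -> (s - l)^+, applied pointwise. *)
Lemma excess_convex y z h a b l : L0 alpha y -> L0 alpha z -> L0 alpha h ->
  (0 <= a)%R -> (0 <= b)%R -> (a + b = 1)%R ->
  aeq alpha h (fun x => a%:C%C * y x + b%:C%C * z x)%R ->
  excess alpha h l <= a%:E * excess alpha y l + b%:E * excess alpha z l.
Proof.
move=> y0 z0 h0 a0 b0 ab hyz.
rewrite -2?ge0_integralZl_EFin; try exact: measurable_Ico0; try exact: measurable_excess => //; try by [];
  try by move=> x _; rewrite lee_fin le_max lexx orbT.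
rewrite -ge0_integralD; try exact: measurable_Ico0;
  try by [apply: emeasurable_funM => //; exact: measurable_excess];
  try by move=> x _; rewrite mule_ge0// lee_fin// le_max lexx orbT.
apply: ae_ge0_le_integral.
- exact: measurable_Ico0.
- by move=> x _; rewrite lee_fin le_max lexx orbT.
- exact: measurable_excess.
- by move=> x _; rewrite adde_ge0// mule_ge0// lee_fin// le_max lexx orbT.
- by apply: emeasurable_funD; apply: emeasurable_funM => //; exact: measurable_excess.
apply: (ae_imp hyz) => x {}hyz Dx; rewrite (hyz Dx).
rewrite -!EFinM -EFinD lee_fin.
have := le_normcD (a%:C%C * y x)%R (b%:C%C * z x)%R.
rewrite !normc_scale !ger0_norm//.
have H (p : R) : (p <= Num.max p 0)%R /\ (0 <= Num.max p 0)%R by rewrite !le_max !lexx orbT.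
have [] := H (normc (y x) - l)%R; have [] := H (normc (z x) - l)%R.
set Y := Num.max _ _; set Z := Num.max _ _ => h1 h2 h3 h4 h5.
rewrite ge_max; apply/andP; split; last by rewrite addr_ge0// mulr_ge0.
have := ler_wpM2l a0 h3; have := ler_wpM2l b0 h1.
have bE : b = (1 - a)%R by rewrite -ab addrAC subrr add0r.
rewrite bE in h5 *; lra.
Qed.

Lemma Omega_convex g y z h a b : L1_plus_Linfty alpha g -> L0 alpha h ->
  (0 <= a)%R -> (0 <= b)%R -> (a + b = 1)%R ->
  Omega alpha g y -> Omega alpha g z ->
  aeq alpha h (fun x => a%:C%C * y x + b%:C%C * z x)%R -> Omega alpha g h.
Proof.
move=> gL h0 a0 b0 ab /(OmegaP _ gL)[y0 yg] /(OmegaP _ gL)[z0 zg] hyz.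
apply/(OmegaP _ gL); split => // l l0.
apply: le_trans (excess_convex l y0 z0 h0 a0 b0 ab hyz) _.
apply: (@le_trans _ _ (a%:E * excess alpha g l + b%:E * excess alpha g l)).
  by apply: leeD; apply: lee_wpmul2l; rewrite ?lee_fin ?yg ?zg.
by rewrite -ge0_muleDl ?lee_fin// -EFinD ab mul1e.
Qed.

Lemma Omega_avg g n (x : 'I_n.+1 -> R -> R[i]) : L1_plus_Linfty alpha g ->
  (forall i, Omega alpha g (x i)) ->
  Omega alpha g (fun t => (n.+1%:R)^-1 * \sum_(i < n.+1) x i t)%R.
Proof.
move=> gL; elim: n x => [|n IH] x xO.
  suff -> : (fun t => (1%:R)^-1 * \sum_(i < 1) x i t)%R = x ord0 by [].
  by apply/funext => t; rewrite big_ord1 invr1 mul1r.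
have x0 i : L0 alpha (x i) by case: (xO i) => -[].
have n1 : (0 <= (n.+2%:R)^-1 :> R)%R by rewrite invr_ge0.
apply: (@Omega_convex g (x ord0) (fun t => (n.+1%:R)^-1 * \sum_(j < n.+1) x (lift ord0 j) t)%R
  _ (n.+2%:R)^-1%R (1 - (n.+2%:R)^-1)%R gL) => //.
- under eq_fun do rewrite real_complex_natV.
  by apply: L0_scale => //; exact: L0_sum.
- by rewrite subr_ge0 invf_le1// ler1n.
- by rewrite addrC subrK.
- by apply: IH => i; exact: xO.
- by apply: aeW => t _; exact: avg_isolate.
Qed.

Lemma excess_eq_normc f h l : (forall x, normc (f x) = normc (h x)) ->
  excess alpha f l = excess alpha h l.
Proof. by move=> E; apply: eq_integral => x _; rewrite E. Qed.

Lemma Omega_refl g : L1_plus_Linfty alpha g -> Omega alpha g g.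
Proof. by move=> gL; split => // t. Qed.

Lemma Omega_opp g : L1_plus_Linfty alpha g -> Omega alpha g (fun x => - g x)%R.
Proof.
move=> gL; have g0 : L0 alpha g by case: gL.
apply/(OmegaP _ gL); split.
  under eq_fun do rewrite -mulN1r -(rmorphN1 (real_complex R)).
  exact: L0_scale.
by move=> l _; rewrite (excess_eq_normc _ (fun x => normcN (g x))).
Qed.

Lemma Omega0 g : L1_plus_Linfty alpha g -> Omega alpha g (fun=> 0%R).
Proof.
move=> gL; apply: (Omega_convex (a := (1 / 2)%R) (b := (1 / 2)%R) gL _ _ _ _ (Omega_refl gL) (Omega_opp gL)).
- exact: L0_cst.
- lra.
- lra.
- lra.
- by apply: aeW => x _; rewrite mulrN subrr.
Qed.

(** If f could be stretched inside the orbit it would lie strictly between its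
    stretched copy and 0, hence be 0; but 0 is the midpoint of g and - g. *)
Lemma extreme_sphere g f : L1_plus_Linfty alpha g -> ~ aeq alpha g (fun=> 0%R) ->
  extreme_point alpha (Omega alpha g) f -> marcinkiewicz_sphere alpha g f.
Proof.
move=> gL gn0 [fO fext]; apply/sphereP => //; split => // r /andP[r0 r1] rf.
have rr : (0 < r < 1)%R by rewrite r0.
have [] := fext _ _ r rf (Omega0 gL) rr.
  by apply: aeW => x _; rewrite mulr0 addr0 mulrA -rmorphM/= mulfV ?gt_eqF// mul1r.
move=> _ f0; apply: gn0.
have h01 : (0 < (1 / 2 : R) < 1)%R by lra.
have [] := fext _ _ (1 / 2)%R (Omega_refl gL) (Omega_opp gL) h01.
  apply: (ae_imp f0) => x {}f0 Dx; rewrite -(f0 Dx).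
  by rewrite (_ : (1 - 1 / 2 = 1 / 2 :> R)%R) ?mulrN ?subrr//; lra.
move=> gf _; apply: (ae_and gf f0) => x {}gf {}f0 Dx.
by rewrite (gf Dx) -(f0 Dx).
Qed.

(** All the points that average to f coincide with f, and two equal vectors are
    linearly dependent. *)
Lemma extreme_k_extreme g f k : L1_plus_Linfty alpha g -> ~ aeq alpha g (fun=> 0%R) ->
  (0 < k)%N -> extreme_point alpha (Omega alpha g) f -> k_extreme_point alpha g k f.
Proof.
move=> gL gn0; case: k => // k _ fext; split; first exact: extreme_sphere.
move=> x xS favg; case: fext => fO fext.
have xO i : Omega alpha g (x i) by have /(sphereP _ gL gn0)[] := xS i.
have xf i : aeq alpha (x i) f.
  have k1 : (0 < ((k.+2%:R)^-1 : R) < 1)%R by rewrite invr_gt0 ltr0n invf_lt1 ?ltr1n// ltr0n.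
  have zO : Omega alpha g (fun t => (k.+1%:R)^-1 * \sum_(j < k.+1) x (lift i j) t)%R.
    exact: (Omega_avg (x := fun j => x (lift i j)) gL (fun j => xO (lift i j))).
  have [] := fext _ _ _ (xO i) zO k1; last by [].
  by apply: (ae_imp favg) => t {}favg Dt; rewrite (favg Dt) (avg_isolate _ i).
pose i0 : 'I_k.+2 := ord0; pose i1 : 'I_k.+2 := ord_max.
exists (fun i => if i == i0 then 1 else if i == i1 then -1 else 0)%R; split.
  by exists i0; rewrite eqxx; exact/eqP/oner_neq0.
apply: (ae_and (xf i0) (xf i1)) => t x0 x1 Dt.
rewrite (bigD1 i0)//= (bigD1 i1)//= big1 => [|j /andP[/negbTE-> /negbTE->]].
  by rewrite eqxx addr0 (x0 Dt) (x1 Dt) mul1r mulN1r subrr.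
by rewrite mul0r.
Qed.

End Convexity.

(** * Equimeasurable functions are extreme *)

Section ExtremeOfEquimeasurable.
Context {R : realType} (alpha : \bar R).
Local Notation m := (@lebesgue_measure R).
Local Notation D := (Ico0 alpha).
Implicit Types (f g h y z : R -> R[i]) (a b c l r s t : R).

Lemma rearr_inftyE f : rearr_infty alpha f = ereal_inf (range (rearr alpha f)).
Proof.
apply/cvg_lim => //; apply: nonincreasing_cvge => s t st.
exact: rearr_nonincreasing.
Qed.

Lemma rearr_infty_le f t : rearr_infty alpha f <= rearr alpha f t.
Proof. by rewrite rearr_inftyE; apply: ereal_inf_lbound; exists t. Qed.

Lemma rearr_infty_ge0 f : 0 <= rearr_infty alpha f.
Proof. by rewrite rearr_inftyE; apply: le_ereal_inf_tmp => _ [t _ <-]; exact: rearr_ge0. Qed.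

(** Lowering the level from l' to l adds at most l' - l, and only where
    |f| > l. *)
Lemma excess_le_shift f l l' : L0 alpha f -> (l <= l')%R ->
  excess alpha f l <= excess alpha f l' + (l' - l)%:E * distribution_fun alpha f l.
Proof.
move=> f0 ll'; have l'l : (0 <= l' - l)%R by rewrite subr_ge0.
pose A := D `&` [set x | (l < normc (f x))%R].
have mA : measurable A by exact: measurable_superlevel.
have -> : distribution_fun alpha f l = \int[m]_(x in D) (\1_A x)%:E.
  rewrite integral_indic//; last exact: measurable_Ico0.
  by congr (m _); apply/seteqP; split => x; [move=> [Dx fx]|case=> [[]]].
rewrite -ge0_integralZl_EFin//; last 2 first.
- exact: measurable_Ico0.
- by apply/measurable_EFinP; exact: measurable_indic.
rewrite -ge0_integralD; last 5 first.
- exact: measurable_Ico0.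
- by move=> x _; rewrite lee_fin le_max lexx orbT.
- exact: measurable_excess.
- by move=> x _; rewrite mule_ge0// lee_fin.
- by apply: emeasurable_funM => //; apply/measurable_EFinP; exact: measurable_indic.
apply: ge0_le_integral.
- exact: measurable_Ico0.
- by move=> x _; rewrite lee_fin le_max lexx orbT.
- exact: measurable_excess.
- apply: emeasurable_funD; first exact: measurable_excess.
  by apply: emeasurable_funM => //; apply/measurable_EFinP; exact: measurable_indic.
move=> x Dx; rewrite -EFinM -EFinD lee_fin indicE.
have Z : (0 <= Num.max (normc (f x) - l') 0)%R by rewrite le_max lexx orbT.
have Y : (normc (f x) - l' <= Num.max (normc (f x) - l') 0)%R by rewrite le_max lexx.
have [lf|fl] := ltP l (normc (f x)).
  rewrite mem_set//= mulr1 ge_max; lra.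
rewrite ge_max addr_ge0 ?mulr_ge0// andbT.
apply: (@le_trans _ _ 0%R); first by rewrite subr_le0.
by rewrite addr_ge0 ?mulr_ge0.
Qed.

(** Above rearr_infty the superlevel sets of f have finite measure. *)
Lemma excess_fin f l : L1_plus_Linfty alpha f -> rearr_infty alpha f < l%:E ->
  excess alpha f l < +oo.
Proof.
move=> fL; have f0 : L0 alpha f by case: fL.
move=> fl; have l0 : (0 <= l)%R.
  by rewrite -lee_fin (le_trans (rearr_infty_ge0 f))// ltW.
move: fl; rewrite rearr_inftyE => /ereal_inf_lt[_ [t _ <-] tl].
have d_fin : distribution_fun alpha f l < +oo.
  apply: (@le_lt_trans _ _ t%:E); last exact: ltry.
  by rewrite leNgt -lt_rearr// -leNgt ltW.
have [l' l'0 fl'] := L1_plus_Linfty_excess_fin fL.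
have [l'l|ll'] := leP l' l; first exact: le_lt_trans (le_excess f0 l'l) fl'.
apply: le_lt_trans (excess_le_shift f0 (ltW ll')) _.
by rewrite lte_add_pinfty// lte_mul_pinfty// lee_fin subr_ge0 ltW.
Qed.

Lemma eq_rearr_excess f g l : L0 alpha f -> L0 alpha g -> (0 <= l)%R ->
  (forall t, (0 <= t)%R -> rearr alpha f t = rearr alpha g t) ->
  excess alpha f l = excess alpha g l.
Proof.
move=> f0 g0 l0 fg; rewrite -(excess_rearr f0 l0) -(excess_rearr g0 l0); apply: eq_integral => t.
by rewrite inE/= in_itv/= andbT => t0; rewrite fg.
Qed.

(** Equality in excess_convex forces equality almost everywhere in the pointwise
    inequality (|f| - l)^+ <= a (|y| - l)^+ + (1 - a) (|z| - l)^+; where the left side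
    vanishes, so do both terms on the right. *)
Lemma excess_tight f y z a l : L0 alpha f -> L0 alpha y -> L0 alpha z ->
  (0 < a < 1)%R -> aeq alpha f (fun x => a%:C%C * y x + (1 - a)%:C%C * z x)%R ->
  excess alpha y l <= excess alpha f l -> excess alpha z l <= excess alpha f l ->
  excess alpha f l < +oo ->
  {ae m, forall x, D x -> (normc (f x) <= l)%R ->
    (normc (y x) <= l)%R /\ (normc (z x) <= l)%R}.
Proof.
move=> f0 y0 z0 /andP[a0 a1] fyz yf zf foo.
have b0 : (0 < 1 - a)%R by rewrite subr_gt0.
pose e h x : R := (Num.max (normc (h x) - l) 0)%R.
have e0 h x : (0 <= e h x)%R by rewrite le_max lexx orbT.
have me h : L0 alpha h -> measurable_fun D (e h).
  by move=> h0; apply/measurable_EFinP; exact: measurable_excess.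
pose q x := (a * e y x + (1 - a) * e z x)%R.
have mq : measurable_fun D q.
  by apply: measurable_funD; apply: measurable_funM => //; exact: me.
have q0 x : (0 <= q x)%R by rewrite addr_ge0// mulr_ge0// ltW.
have fq : {ae m, forall x, D x -> (e f x <= q x)%R}.
  apply: (ae_imp fyz) => x {}fyz Dx.
  rewrite /e (fyz Dx) ge_max q0 andbT.
  have := le_normcD (a%:C%C * y x)%R ((1 - a)%:C%C * z x)%R.
  rewrite !normc_scale !gtr0_norm//.
  have hy : (normc (y x) - l <= e y x)%R by rewrite le_max lexx.
  have hz : (normc (z x) - l <= e z x)%R by rewrite le_max lexx.
  have := ler_wpM2l (ltW a0) hy; have := ler_wpM2l (ltW b0) hz; rewrite /q; lra.
have intq : \int[m]_(x in D) (q x)%:E <= excess alpha f l.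
  under eq_integral do rewrite EFinD !EFinM.
  rewrite ge0_integralD; last 5 first.
  - exact: measurable_Ico0.
  - by move=> x _; rewrite -EFinM lee_fin mulr_ge0// ltW.
  - by apply: emeasurable_funM => //; apply/measurable_EFinP; exact: me.
  - by move=> x _; rewrite -EFinM lee_fin mulr_ge0// ltW.
  - by apply: emeasurable_funM => //; apply/measurable_EFinP; exact: me.
  rewrite !ge0_integralZl_EFin; try exact: ltW; try exact: measurable_Ico0;
    try by [move=> x _; rewrite lee_fin]; try by [apply/measurable_EFinP; exact: me].
  apply: (@le_trans _ _ (a%:E * excess alpha f l + (1 - a)%:E * excess alpha f l)).
    by apply: leeD; apply: lee_wpmul2l => //; rewrite lee_fin ltW.
  rewrite -ge0_muleDl ?lee_fin; [|exact: ltW..].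
  by rewrite -EFinD [(a + _)%R]addrC subrK mul1e.
pose w x : R := (Num.max (q x - e f x) 0)%R.
have w0 x : (0 <= w x)%R by rewrite le_max lexx orbT.
have mw : measurable_fun D w.
  by apply: measurable_maxr => //; apply: measurable_funB => //; exact: me.
have intw : \int[m]_(x in D) (w x)%:E = 0.
  have : \int[m]_(x in D) ((e f x)%:E + (w x)%:E) = \int[m]_(x in D) (q x)%:E.
    apply: ge0_ae_eq_integral.
    - exact: measurable_Ico0.
    - by apply: emeasurable_funD; apply/measurable_EFinP => //; exact: me.
    - exact/measurable_EFinP.
    - by move=> x _; rewrite adde_ge0 ?lee_fin.
    - by move=> x _; rewrite lee_fin.
    apply: (ae_imp fq) => x {}fq Dx.
    by rewrite -EFinD /w max_l ?subr_ge0 ?fq// addrC subrK.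
  rewrite ge0_integralD; last 5 first.
  - exact: measurable_Ico0.
  - by move=> x _; rewrite lee_fin.
  - by apply/measurable_EFinP; exact: me.
  - by move=> x _; rewrite lee_fin.
  - exact/measurable_EFinP.
  move=> E; apply/le_anti/andP; split; last by apply: integral_ge0 => x _; rewrite lee_fin.
  rewrite -(@leeD2lE _ (excess alpha f l)).
    by rewrite adde0 (le_trans _ intq)// -E.
  by rewrite ge0_fin_numE// excess_ge0.
have wae : {ae m, forall x, D x -> (w x)%:E = 0}.
  apply/(@ae_eq_integral_abs _ _ _ m D (measurable_Ico0 alpha)).
    exact/measurable_EFinP.
  by rewrite -intw; apply: eq_integral => x _; rewrite gee0_abs// lee_fin.
apply: (ae_imp wae) => x {}wae Dx fl; have [wx0] := wae Dx.
have fe : e f x = 0%R by apply/max_r; rewrite subr_le0.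
have qx : (q x <= 0)%R by rewrite -wx0 /w fe subr0 le_max lexx.
have hy : (normc (y x) - l <= e y x)%R by rewrite le_max lexx.
have hz : (normc (z x) - l <= e z x)%R by rewrite le_max lexx.
have /andP[/eqP A1 /eqP A2] : (a * e y x == 0)%R && ((1 - a) * e z x == 0)%R.
  by rewrite -paddr_eq0 ?mulr_ge0 ?(ltW a0) ?(ltW b0)// eq_le qx q0.
move: A1 A2 => /eqP; rewrite mulf_eq0 gt_eqF//= => /eqP ey.
move=> /eqP; rewrite mulf_eq0 gt_eqF//= => /eqP ez.
by rewrite -subr_le0 -ey hy -subr_le0 -ez hz.
Qed.

(** Here f and g have the same excess, so excess_tight applies at all rational
    levels above rearr_infty and gives |y| <= |f| and |z| <= |f| almost everywhere,
    because |f| is nowhere below rearr_infty. Strict convexity of the modulus then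
    leaves only y = z = f. *)
Lemma equimeasurable_extreme f g : L1_plus_Linfty alpha f -> L1_plus_Linfty alpha g ->
  (forall t, (0 <= t)%R -> rearr alpha f t = rearr alpha g t) ->
  {ae m, forall x, D x -> rearr_infty alpha f <= (normc (f x))%:E} ->
  extreme_point alpha (Omega alpha g) f.
Proof.
move=> fL gL fg finf.
have f0 : L0 alpha f by case: fL.
have g0 : L0 alpha g by case: gL.
have E l : (0 <= l)%R -> excess alpha f l = excess alpha g l.
  by move=> l0; apply: eq_rearr_excess.
split; first by apply/(OmegaP _ gL); split => // l l0; rewrite E.
move=> y z a /(OmegaP _ gL)[y0 yg] /(OmegaP _ gL)[z0 zg] a01 fyz.
have H (q : rat) : {ae m, forall x, D x ->
    rearr_infty alpha f < (ratr q)%:E -> (normc (f x) <= ratr q)%R ->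
    (normc (y x) <= ratr q)%R /\ (normc (z x) <= ratr q)%R}.
  have [ql|] := boolP (rearr_infty alpha f < (ratr q)%:E); last first.
    by move=> _; apply: aeW.
  have q0 : (0 <= ratr q :> R)%R by rewrite -lee_fin (le_trans (rearr_infty_ge0 f))// ltW.
  have := excess_tight f0 y0 z0 a01 fyz; move/(_ (ratr q)).
  rewrite E// yg// zg// -E// => /(_ isT isT (excess_fin fL ql)) ae1.
  by apply: (ae_imp ae1) => x + Dx _; apply.
have {}H : {ae m, forall x, forall n, forall q : rat, unpickle n = Some q -> D x ->
    rearr_infty alpha f < (ratr q)%:E -> (normc (f x) <= ratr q)%R ->
    (normc (y x) <= ratr q)%R /\ (normc (z x) <= ratr q)%R}.
  apply/ae_foralln => n; case: (unpickle n) => [q|]; last exact: aeW.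
  by apply: (ae_imp (H q)) => x Hx _ [<-].
have K : {ae m, forall x, D x -> y x = f x /\ z x = f x}.
  apply: (ae_and (ae_and H finf (fun x A B => conj A B)) fyz).
  move=> x [{}H {}finf] {}fyz Dx.
  have {}H (q : rat) : (normc (f x) < ratr q)%R ->
      (normc (y x) <= ratr q)%R /\ (normc (z x) <= ratr q)%R.
    move=> fq; apply: (H (pickle q) q) => //; first exact: pickleK; last exact: ltW.
    by apply: le_lt_trans (finf Dx) _; rewrite lte_fin.
  apply: (normc_strict_convex a01 (fyz Dx)); rewrite leNgt; apply/negP => fy.
    have [q] := rat_in_itvoo fy; rewrite in_itv/= => /andP[fq qy].
    by have [] := H q fq; rewrite leNgt qy.
  have [q] := rat_in_itvoo fy; rewrite in_itv/= => /andP[fq qy].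
  by have [_] := H q fq; rewrite leNgt qy.
by split; apply: (ae_imp K) => x {}K Dx; have [] := K Dx.
Qed.

End ExtremeOfEquimeasurable.

(** * Perturbations that stay in the orbit *)

Section Perturbation.
Context {R : realType} (alpha : \bar R).
Local Notation m := (@lebesgue_measure R).
Local Notation D := (Ico0 alpha).
Implicit Types (f g h w : R -> R[i]) (a b c l r s t : R) (p n : R -> R).

(** A measurable choice of sign, equal to 1 where f vanishes; it turns a real
    perturbation of |f| into a perturbation of f. *)
Lemma phaseP f : L0 alpha f -> exists2 w, L0 alpha w &
  forall x, D x -> normc (w x) = 1%R /\ f x = ((normc (f x))%:C%C * w x)%R.
Proof.
move=> f0; have mf := measurable_normc f0.
pose A := D `&` [set x | (0 < normc (f x))%R].
have mA : measurable A by exact: measurable_superlevel.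
exists (fun x => (normc (f x) `^ (-1))%:C%C * f x + (1 - \1_A x)%:C%C * 1)%R.
  apply: L0_add; apply: L0_scale => //.
  - exact: (measurableT_comp (measurable_powR _)).
  - by apply: measurable_funB => //; exact: measurable_indic.
move=> x Dx; rewrite powR_inv1 ?normc_ge0// indicE.
have [fx0|fx0] := eqVneq (normc (f x)) 0%R.
  rewrite memNset; last by case; rewrite /= fx0 ltxx.
  by rewrite subr0 (eq0_normc fx0) mulr0 add0r mulr1 normc1 normc0 mul0r.
rewrite mem_set; last by split => //=; rewrite lt_def fx0 normc_ge0.
rewrite subrr mul0r addr0 normc_scale ger0_norm ?invr_ge0 ?normc_ge0// mulVf//.
by split => //; rewrite mulrA -rmorphM/= mulfV// mul1r.
Qed.

Lemma normc_perturb f w c x : normc (w x) = 1%R -> f x = ((normc (f x))%:C%C * w x)%R ->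
  normc (f x + c%:C%C * w x)%R = `|normc (f x) + c|%R.
Proof. by move=> w1 fw; rewrite {1}fw -mulrDl -rmorphD/= normc_scale w1 mulr1. Qed.

(** A perturbation p - n of |f| of mean zero, supported where |f| lies in [a, b]
    and bounded by e. At levels above b + e the truncations do not see it; at levels
    below a - e they are linear on its support, so only its mean counts; at the levels
    in between it costs at most c + c, for which room is assumed. Keeping p and n apart
    allows all integrands to be nonnegative. *)
Lemma Omega_perturb f g w p n a b c e : L1_plus_Linfty alpha g -> Omega alpha g f ->
  L0 alpha w ->
  (forall x, D x -> normc (w x) = 1%R /\ f x = ((normc (f x))%:C%C * w x)%R) ->
  measurable_fun D p -> measurable_fun D n ->
  (forall x, D x -> 0 <= p x <= e)%R -> (forall x, D x -> 0 <= n x <= e)%R ->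
  (forall x, D x -> (p x = 0 /\ n x = 0)%R \/ (a <= normc (f x) <= b)%R) ->
  \int[m]_(x in D) (p x)%:E = c%:E -> \int[m]_(x in D) (n x)%:E = c%:E ->
  (forall l, (0 <= l)%R -> (a - e <= l <= b + e)%R ->
    excess alpha f l + (c + c)%:E <= excess alpha g l) ->
  Omega alpha g (fun x => f x + (p x - n x)%:C%C * w x)%R.
Proof.
move=> gL /(OmegaP _ gL)[f0 fg] w0 fw mp mn pe ne pn ip inn gap.
set h := (fun x => _).
have h0 : L0 alpha h.
  by apply: L0_add => //; apply: L0_scale => //; exact: measurable_funB.
have hn x : D x -> normc (h x) = `|normc (f x) + (p x - n x)|%R.
  by move=> Dx; have [w1 fx] := fw x Dx; exact: normc_perturb.
apply/(OmegaP _ gL); split => // l l0.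
have mE f' : L0 alpha f' -> measurable_fun D (fun x => (Num.max (normc (f' x) - l) 0)%:E).
  exact: measurable_excess.
have E0 (f' : R -> R[i]) x : D x -> 0 <= (Num.max (normc (f' x) - l) 0)%:E.
  by move=> _; rewrite lee_fin le_max lexx orbT.
have P0 x : D x -> 0 <= (p x)%:E by move=> /pe/andP[]; rewrite lee_fin.
have N0 x : D x -> 0 <= (n x)%:E by move=> /ne/andP[]; rewrite lee_fin.
have mP : measurable_fun D (fun x => (p x)%:E) by exact/measurable_EFinP.
have mN : measurable_fun D (fun x => (n x)%:E) by exact/measurable_EFinP.
have mD := measurable_Ico0 alpha.
have [lb|bl] := leP l (b + e)%R; last first.
  (* both truncations vanish on the support of the perturbation *)
  suff -> : excess alpha h l = excess alpha f l by exact: fg.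
  apply: eq_integral => x /set_mem Dx; rewrite hn//.
  case: (pn x Dx) => [[-> ->]|/andP[_ fb]].
    by rewrite subr0 addr0 ger0_norm// normc_ge0.
  have := pe x Dx; have := ne x Dx; have := normc_ge0 (f x).
  move=> f0' /andP[n0 nle] /andP[p0 ple].
  rewrite !max_r//; first by lra.
  by rewrite subr_le0 ler_norml; apply/andP; split; lra.
have [al|la] := leP (a - e)%R l.
  apply: le_trans (gap l l0 _); last by rewrite al.
  have -> : excess alpha f l + (c + c)%:E =
    \int[m]_(x in D) ((Num.max (normc (f x) - l) 0)%:E + ((p x)%:E + (n x)%:E)).
    rewrite ge0_integralD//; try exact: mE; try exact: E0; try exact: emeasurable_funD;
      try by move=> x Dx; rewrite adde_ge0 ?P0 ?N0.
    rewrite ge0_integralD//.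
    by rewrite ip inn.
  apply: ge0_le_integral => //.
  - exact: E0.
  - exact: mE.
  - by apply: emeasurable_funD; [exact: mE|exact: emeasurable_funD].
  move=> x Dx; rewrite -!EFinD lee_fin hn//.
  have := pe x Dx; have := ne x Dx; have f0' := normc_ge0 (f x).
  move=> /andP[n0 nle] /andP[p0 ple].
  have H1 : (normc (f x) - l <= Num.max (normc (f x) - l) 0)%R by rewrite le_max lexx.
  have H2 : (0 <= Num.max (normc (f x) - l) 0)%R by rewrite le_max lexx orbT.
  have H3 : (`|normc (f x) + (p x - n x)| <= normc (f x) + p x + n x)%R.
    by rewrite ler_norml; apply/andP; split; lra.
  rewrite ge_max; apply/andP; split; lra.
(* on the support both truncations are linear in the modulus *)
suff -> : excess alpha h l = excess alpha f l by exact: fg.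
have : \int[m]_(x in D) ((Num.max (normc (h x) - l) 0)%:E + (n x)%:E) =
       \int[m]_(x in D) ((Num.max (normc (f x) - l) 0)%:E + (p x)%:E).
  apply: eq_integral => x /set_mem Dx; rewrite hn// -!EFinD; congr (_%:E).
  case: (pn x Dx) => [[-> ->]|/andP[fa _]].
    by rewrite subr0 !addr0 ger0_norm// normc_ge0.
  have := pe x Dx; have := ne x Dx; have f0' := normc_ge0 (f x).
  move=> /andP[n0 nle] /andP[p0 ple].
  rewrite ger0_norm; last by lra.
  by rewrite !max_l; lra.
rewrite ge0_integralD//; try exact: mE; try exact: E0.
rewrite ge0_integralD//; try exact: mE; try exact: E0.
rewrite ip inn => E; rewrite -[LHS](@addeK _ c%:E)// -[RHS](@addeK _ c%:E)//.
by congr (_ - _).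
Qed.

End Perturbation.

(** * Linearly independent perturbations *)

Section Splitting.
Context {R : realType}.
Local Notation m := (@lebesgue_measure R).
Implicit Types (A E : set R).

Lemma bounded_subset_gt0 E : measurable E -> E `<=` [set x | (0 <= x)%R] -> 0 < m E ->
  exists N : nat, 0 < m (E `&` `[0%R, N%:R]).
Proof.
move=> mE E0 Egt0; apply: measure_bigcup_gt0.
  by move=> n; exact: measurableI.
rewrite (_ : \bigcup_n _ = E)//; apply/seteqP; split => x; first by case=> n _ [].
move=> Ex; have [n xn] : exists n : nat, (x <= n%:R)%R.
  by exists (Num.bound x); rewrite ltW// archi_boundP// E0.
by exists n => //; split => //=; rewrite in_itv/= xn E0.
Qed.

(** Otherwise E has either no mass or full mass to the left of every t, so that
    all its mass sits in arbitrarily short intervals around one point. *)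
Lemma split_measure_gt0 E (b : R) : measurable E -> E `<=` `[0%R, b] -> 0 < m E ->
  exists t : R, 0 < m (E `&` `]-oo, t]) /\ 0 < m (E `&` `]t, +oo[).
Proof.
move=> mE Eb E0; apply: contrapT => /forallNP H.
pose V t := m (E `&` `]-oo, t]).
pose W t := m (E `&` `]t, +oo[).
have mV (t : R) : measurable (E `&` `]-oo, t]) by exact: measurableI.
have mW (t : R) : measurable (E `&` `]t, +oo[) by exact: measurableI.
have VW t : V t = 0 \/ W t = 0.
  have [V0|/eqP V0] := pselect (V t = 0); first by left.
  right; apply: contrapT => /eqP W0; apply: (H t).
  by rewrite !lt0e V0 W0 !measure_ge0.
pose S := [set t : R | V t = 0].
have Sm : S (-1)%R.
  rewrite /S/= /V (_ : _ `&` _ = set0) ?measure0//.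
  by apply/seteqP; split => // x [/Eb/=]; rewrite !in_itv/= => /andP[? _]; lra.
have Sub : ubound S b.
  move=> t St; rewrite leNgt; apply/negP => bt.
  move: E0; rewrite -(_ : E `&` `]-oo, t] = E); first by rewrite [m _]St ltxx.
  apply/setIidPl => x /Eb/=; rewrite !in_itv/= => /andP[_ /le_trans]; apply.
  exact: ltW.
have hS : has_sup S by split; [exists (-1)%R|exists b].
(* no mass to the left of sup S - e, nor to the right of sup S + e *)
have key (e : R) : (0 < e)%R -> m E <= (e + e)%:E.
  move=> e0.
  have [t St te] := sup_adherent e0 hS.
  have nS : W (sup S + e)%R = 0.
    case: (VW (sup S + e)%R) => // VS; exfalso.
    have := @sup_upper_bound _ S hS _ VS; lra.
  have tS : (t <= sup S)%R by exact: sup_upper_bound.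
  have EU : E `<=` ((E `&` `]-oo, t]) `|` (E `&` `](sup S + e)%R, +oo[)) `|` `[t, (sup S + e)%R].
    move=> x Ex; have [xt|tx] := leP x t; first by left; left; split => //=; rewrite in_itv.
    have [xs|sx] := leP x (sup S + e)%R; first by right; rewrite /= in_itv/= xs ltW.
    by left; right; split => //=; rewrite in_itv/= sx.
  have mU1 := measurableU _ _ (mV t) (mW (sup S + e)%R).
  have mI : measurable (`[t, (sup S + e)%R]%classic : set R) by exact: measurable_itv.
  apply: (@le_trans _ _ (m (((E `&` `]-oo, t]) `|` (E `&` `](sup S + e)%R, +oo[)) `|` `[t, (sup S + e)%R]))).
    by apply: le_measure => //; rewrite inE//; exact: measurableU.
  apply: le_trans (@measureU2 _ _ _ m _ _ mU1 mI) _.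
  have Z1 : m (E `&` `]-oo, t] `|` E `&` `](sup S + e)%R, +oo[) <= 0.
    apply: le_trans (@measureU2 _ _ _ m _ _ (mV t) (mW _)) _.
    have Vt : m (E `&` `]-oo, t]) = 0 by exact: St.
    have Ws : m (E `&` `](sup S + e)%R, +oo[) = 0 by exact: nS.
    by rewrite /= Vt Ws adde0.
  rewrite -[leRHS]add0e; apply: leeD => //.
  rewrite /= lebesgue_measure_itv/= lte_fin; case: ifPn => [_|_]; rewrite ?lee_fin; lra.
have mEfin : m E < +oo by apply: (le_lt_trans (key 1%R ltr01)); exact: ltry.
move: E0 mEfin key; case: (m E) => [v| |]// v0 _ /(_ (v / 3)%R).
rewrite lte_fin in v0; rewrite lee_fin; move=> /(_ _)/wrap[]; first by lra.
lra.
Qed.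

(** By iterating split_measure_gt0. *)
Lemma disjoint_pieces k E (b : R) : measurable E -> E `<=` `[0%R, b] -> 0 < m E ->
  exists F : nat -> set R, [/\ forall i, (i < k)%N -> measurable (F i),
    forall i, (i < k)%N -> F i `<=` E, forall i, (i < k)%N -> 0 < m (F i) &
    forall i j x, (i < k)%N -> (j < k)%N -> F i x -> F j x -> i = j].
Proof.
elim: k E => [|k IH] E mE Eb E0; first by exists (fun=> set0).
have [t [V0 W0]] := split_measure_gt0 mE Eb E0.
have mV : measurable (E `&` `]-oo, t]) by exact: measurableI.
have mW : measurable (E `&` `]t, +oo[) by exact: measurableI.
have [|F [mF FE F0 Fd]] := IH _ mW _ W0; first by apply: subset_trans Eb => x [].
exists (fun i => if i is j.+1 then F j else E `&` `]-oo, t]); split.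
- by case=> [|i]; [|exact: mF].
- by case=> [_ x []//|i ik x /(FE i ik) []].
- by case=> [|i]; [|exact: F0].
case=> [|i] [|j] x// ik jk.
- by move=> [_ /=]; rewrite in_itv/= => xt /(FE j jk) [_ /=]; rewrite in_itv/= andbT ltNge xt.
- by move=> /(FE i ik) [_ /=]; rewrite in_itv/= andbT => tx [_ /=]; rewrite in_itv/= leNgt tx.
- by move=> Fi Fj; rewrite (Fd i j x).
Qed.

End Splitting.

Section Family.
Context {R : realType} (alpha : \bar R).
Local Notation m := (@lebesgue_measure R).
Local Notation D := (Ico0 alpha).
Implicit Types (f g h w : R -> R[i]) (a b e r s t : R).

(** Centering is self-adjoint. *)
Lemma sum_centered n (c : 'I_n.+1 -> R[i]) (u : 'I_n.+1 -> R) :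
  (\sum_l c l * (u l - (n.+1%:R)^-1 * \sum_j u j)%:C%C =
   \sum_l (c l - (n.+1%:R)^-1 * \sum_j c j) * (u l)%:C%C)%R.
Proof.
under eq_bigr do rewrite rmorphB/= mulrBr.
under [RHS]eq_bigr do rewrite mulrBl.
rewrite !sumrB -!big_distrl -!big_distrr/=; congr (_ - _)%R.
rewrite real_complex_natV rmorphM rmorph_sum/=; ring.
Qed.

Lemma sphere_neq0 g f : L1_plus_Linfty alpha g -> ~ aeq alpha g (fun=> 0%R) ->
  marcinkiewicz_sphere alpha g f -> ~ aeq alpha f (fun=> 0%R).
Proof.
move=> gL gn0 /(sphereP _ gL gn0)[fO fr] f0.
have h2 : (0 < (1 / 2 : R) < 1)%R by lra.
apply: (fr _ h2).
apply: (Omega_convex (a := 1%R) (b := 0%R) gL _ _ _ _ (Omega0 gL) (Omega0 gL)) => //.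
- by apply: L0_scale => //; case: fO => -[].
- by rewrite addr0.
- by apply: (ae_imp f0) => x {}f0 Dx; rewrite (f0 Dx) !mulr0 addr0.
Qed.

(** If x i could be stretched by r^-1 inside the orbit, then so could f by a smaller
    factor: writing a for the weight of x i in the average, the factor is the inverse
    of a r + (1 - a). *)
Lemma avg_sphere g f k (x : 'I_k.+2 -> R -> R[i]) : L1_plus_Linfty alpha g ->
  ~ aeq alpha g (fun=> 0%R) ->
  marcinkiewicz_sphere alpha g f -> (forall i, Omega alpha g (x i)) ->
  aeq alpha f (fun t => (k.+2%:R)^-1 * \sum_(i < k.+2) x i t)%R ->
  forall i, marcinkiewicz_sphere alpha g (x i).
Proof.
move=> gL gn0 /(sphereP _ gL gn0)[fO fr] xO favg i.
apply/(sphereP _ gL gn0); split; first exact: xO.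
move=> r /andP[r0 r1] rx.
pose a : R := ((k.+2%:R)^-1)%R.
have a0 : (0 < a)%R by rewrite invr_gt0 ltr0n.
have a1 : (a < 1)%R by rewrite invf_lt1 ?ltr1n// ltr0n.
pose q : R := (a * r + (1 - a))%R.
have ar : (0 < a * r)%R by rewrite mulr_gt0.
have ar' : (a * r < a)%R by rewrite -[ltRHS]mulr1 ltr_pM2l.
have q0 : (0 < q)%R by rewrite /q; lra.
have q1 : (q < 1)%R by rewrite /q; lra.
have q01 : (0 < q < 1)%R by rewrite q0.
apply: (fr q q01).
have zO := Omega_avg (x := fun j => x (lift i j)) gL (fun j => xO (lift i j)).
apply: (Omega_convex (a := (q^-1 * (a * r))%R) (b := (q^-1 * (1 - a))%R) gL _ _ _ _ rx zO).
- by apply: L0_scale => //; case: fO => -[].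
- by rewrite mulr_ge0 ?invr_ge0// ltW.
- by rewrite mulr_ge0 ?invr_ge0 ?subr_ge0// ltW.
- by rewrite -mulrDr mulVf// gt_eqF.
apply: (ae_imp favg) => t {}favg Dt; rewrite (favg Dt) (avg_isolate _ i) -/a.
rewrite mulrDr !mulrA -!rmorphM/= -/a; congr (_ + _)%R; congr ((_)%:C%C * _)%R.
by rewrite -!mulrA mulfV ?gt_eqF// mulr1.
Qed.

Definition mean n (U : 'I_n.+1 -> R -> R) (x : R) : R :=
  ((n.+1%:R)^-1 * \sum_j U j x)%R.

Lemma mean_bounds n (U : 'I_n.+1 -> R -> R) x s :
  (forall i, 0 <= U i x <= s)%R -> (0 <= mean U x <= s)%R.
Proof.
move=> Us; rewrite mulr_ge0 ?invr_ge0 ?sumr_ge0//=; last first.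
  by move=> i _; have /andP[] := Us i.
rewrite ler_pdivrMl ?ltr0n//; apply: (@le_trans _ _ (\sum_(j < n.+1) s)%R).
  by apply: ler_sum => i _; have /andP[] := Us i.
by rewrite sumr_const card_ord mulr_natl.
Qed.

Lemma measurable_mean n (U : 'I_n.+1 -> R -> R) :
  (forall i, measurable_fun D (U i)) -> measurable_fun D (mean U).
Proof. by move=> mU; apply: measurable_funM => //; exact: measurable_sum. Qed.

Lemma integral_mean n (U : 'I_n.+1 -> R -> R) :
  (forall i, measurable_fun D (U i)) -> (forall i x, (0 <= U i x)%R) ->
  (forall i, \int[m]_(x in D) (U i x)%:E = 1) ->
  \int[m]_(x in D) (mean U x)%:E = 1.
Proof.
move=> mU U0 iU; under eq_integral do rewrite EFinM -sumEFin.
have mD := measurable_Ico0 alpha.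
rewrite ge0_integralZl_EFin//; last 2 first.
- by move=> x _; apply: sume_ge0 => i _; rewrite lee_fin.
- under eq_fun do rewrite sumEFin.
  by apply/measurable_EFinP; exact: measurable_sum.
rewrite ge0_integral_sum//; last 2 first.
- by move=> i; apply/measurable_EFinP; exact: mU.
- by move=> i x _; rewrite lee_fin.
under eq_bigr do rewrite iU.
by rewrite sumEFin sumr_const card_ord -EFinM mulVf// pnatr_eq0.
Qed.

Lemma integral_scaled_sum (u v : R -> R) c : (0 <= c)%R ->
  measurable_fun D u -> measurable_fun D v ->
  (forall x, 0 <= u x)%R -> (forall x, 0 <= v x)%R ->
  \int[m]_(x in D) (u x)%:E = 1 -> \int[m]_(x in D) (v x)%:E = 1 ->
  \int[m]_(x in D) (c * (u x + v x))%:E = (c + c)%:E.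
Proof.
move=> c0 mu mv u0 v0 iu iv; under eq_integral do rewrite EFinM EFinD.
have mD := measurable_Ico0 alpha.
rewrite ge0_integralZl_EFin//; last 2 first.
- by move=> x _; rewrite -EFinD lee_fin addr_ge0.
- by apply: emeasurable_funD; exact/measurable_EFinP.
rewrite ge0_integralD//; last 4 first.
- by move=> x _; rewrite lee_fin.
- exact/measurable_EFinP.
- by move=> x _; rewrite lee_fin.
- exact/measurable_EFinP.
by rewrite iu iv -EFinD -EFinM mulrDr mulr1.
Qed.

Definition bump (A : set R) (x : R) : R := ((fine (m A))^-1 * \1_A x)%R.

Lemma bump_ge0 A x : (0 <= bump A x)%R.
Proof. by rewrite mulr_ge0 ?invr_ge0 ?fine_ge0 ?measure_ge0. Qed.

Lemma bump_le A x : (bump A x <= (fine (m A))^-1)%R.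
Proof.
by rewrite -[leRHS]mulr1 ler_wpM2l ?invr_ge0 ?fine_ge0 ?measure_ge0// indicE lern1 leq_b1.
Qed.

Lemma bump_in A x : A x -> bump A x = ((fine (m A))^-1)%R.
Proof. by move=> Ax; rewrite /bump indicE mem_set// mulr1. Qed.

Lemma bump_out A x : ~ A x -> bump A x = 0%R.
Proof. by move=> Ax; rewrite /bump indicE memNset// mulr0. Qed.

Lemma measurable_bump A : measurable A -> measurable_fun D (bump A).
Proof. by move=> mA; apply: measurable_funM => //; exact: measurable_indic. Qed.

Lemma fine_measure_gt0 (A : set R) r : measurable A -> A `<=` `[0%R, r] -> 0 < m A ->
  m A = (fine (m A))%:E /\ (0 < fine (m A))%R.
Proof.
move=> mA Ar A0.
have Aoo : m A < +oo.
  apply: (@le_lt_trans _ _ (m `[0%R, r])).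
    by apply: le_measure; rewrite ?inE.
  by rewrite /= lebesgue_measure_itv/=; case: ifPn => _; rewrite ?ltry// -EFinB ltry.
by split; [rewrite fineK// gt0_fin_numE|rewrite fine_gt0// A0].
Qed.

Lemma integral_bump A r : measurable A -> A `<=` D -> A `<=` `[0%R, r] -> 0 < m A ->
  \int[m]_(x in D) (bump A x)%:E = 1.
Proof.
move=> mA AD Ar A0; have [Afin A0'] := fine_measure_gt0 mA Ar A0.
have mD := measurable_Ico0 alpha.
under eq_integral do rewrite EFinM.
rewrite ge0_integralZl_EFin//; last 2 first.
- by apply/measurable_EFinP; exact: measurable_indic.
- by rewrite invr_ge0 ltW.
rewrite integral_indic// setIidl//.
by rewrite [X in _ * X]Afin -EFinM mulVf// gt_eqF.
Qed.

(** The difference U i - V i is a dipole: it has mean zero, and it takes a positive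
    and a negative value on sets of positive measure where the other dipoles vanish.
    The sign change is what makes perturbations by dipoles linearly independent
    whatever the values of |f| are. *)
Lemma dipoles k (E : set R) r : measurable E -> E `<=` D -> E `<=` `[0%R, r] -> 0 < m E ->
  exists U V : 'I_k.+1 -> R -> R, [/\
    forall i, measurable_fun D (U i) /\ measurable_fun D (V i),
    forall i, \int[m]_(x in D) (U i x)%:E = 1 /\ \int[m]_(x in D) (V i x)%:E = 1,
    exists2 s, (0 < s)%R & forall i x, (0 <= U i x <= s)%R /\ (0 <= V i x <= s)%R,
    forall i x, ~ E x -> (U i x = 0 /\ V i x = 0)%R &
    forall i, exists A B : set R, exists a b, [/\ measurable A /\ A `<=` D, measurable B /\ B `<=` D,
       0 < m A /\ 0 < m B, (0 < a)%R /\ (0 < b)%R &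
       (forall x, A x -> forall j, U j x - V j x = if j == i then a else 0)%R /\
       (forall x, B x -> forall j, U j x - V j x = if j == i then - b else 0)%R]].
Proof.
move=> mE ED Er E0; pose N := k.+1.
have [F [mF FE F0 Fd]] := disjoint_pieces (N + N) mE Er E0.
have iN (i : 'I_N) : (i < N + N)%N by rewrite ltn_addr.
have Ni (i : 'I_N) : (N + i < N + N)%N by rewrite ltn_add2l.
have Fr i : (i < N + N)%N -> F i `<=` `[0%R, r] by move=> /FE iE; exact: subset_trans Er.
have FD i : (i < N + N)%N -> F i `<=` D by move=> /FE iE; exact: subset_trans ED.
have F0' i : (i < N + N)%N -> (0 < (fine (m (F i)))^-1)%R.
  by move=> iNN; rewrite invr_gt0; have [] := fine_measure_gt0 (mF i iNN) (Fr i iNN) (F0 i iNN).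
pose U (i : 'I_N) := bump (F i); pose V (i : 'I_N) := bump (F (N + i)%N).
exists U, V; split.
- by move=> i; split; apply: measurable_bump; exact: mF.
- by move=> i; split; apply: (@integral_bump _ r);
    [exact: mF|exact: FD|exact: Fr|exact: F0|exact: mF|exact: FD|exact: Fr|exact: F0].
- pose s : R := (\sum_(i < N) ((fine (m (F i)))^-1 + (fine (m (F (N + i)%N)))^-1))%R.
  have le_s (i : 'I_N) : ((fine (m (F i)))^-1 + (fine (m (F (N + i)%N)))^-1 <= s)%R.
    rewrite /s (bigD1 i)//= lerDl sumr_ge0// => j _.
    by rewrite addr_ge0// ltW ?F0'.
  have s0 : (0 < s)%R by apply: lt_le_trans (le_s ord0); rewrite addr_gt0 ?F0'.
  exists s => // i x; rewrite /U /V !bump_ge0/=; split; apply: (le_trans (bump_le _ _)).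
    by apply: le_trans (le_s i); rewrite lerDl ltW ?F0'.
  by apply: le_trans (le_s i); rewrite lerDr ltW ?F0'.
- by move=> i x nE; split; apply: bump_out => Fx; apply: nE; apply: FE Fx.
move=> i; exists (F i), (F (N + i)%N), ((fine (m (F i)))^-1)%R, ((fine (m (F (N + i)%N)))^-1)%R.
split; [by split; [exact: mF|exact: FD]|by split; [exact: mF|exact: FD]
  |by split; exact: F0|by split; exact: F0'|split => x Fx j].
- rewrite /U /V [bump (F (N + j)%N) x]bump_out ?subr0; last first.
    by move=> Fx'; have := ltn_ord i;
      rewrite [X in (X < _)%N](Fd _ _ _ (iN i) (Ni j) Fx Fx') ltnNge leq_addr.
  case: eqVneq => [->|ji]; first exact: bump_in.
  by apply: bump_out => Fx'; move/eqP: ji; apply; apply/val_inj; exact: Fd Fx' Fx.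
- rewrite /U /V [bump (F j) x]bump_out ?sub0r; last first.
    by move=> Fx'; have := ltn_ord j;
      rewrite [X in (X < _)%N](Fd _ _ _ (iN j) (Ni i) Fx' Fx) ltnNge leq_addr.
  case: eqVneq => [->|ji]; first by rewrite bump_in.
  rewrite bump_out ?oppr0// => Fx'; move/eqP: ji; apply; apply/val_inj/(@addnI N).
  exact: Fd Fx' Fx.
Qed.

Lemma complexR_eq0 (c : R) : (c%:C%C == 0 :> R[i])%R = (c == 0%R).
Proof. by rewrite eq_complex/= eqxx andbT. Qed.

(** Let C be the sum of the c i, and d i = c i - C / (k + 1). A vanishing
    combination of the f + K (u i - mean u) w gives C |f| = - K a (d i) at a point of
    the positive pole of the i-th dipole and C |f| = K b (d i) at a point of the
    negative one. As |f| >= 0, either C = 0 or d i = 0. If C were not 0, all the d i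
    would vanish, leaving C f = 0; so C = 0, and the same equations give c i = d i = 0. *)
Lemma dipoles_independent k f w (u : 'I_k.+1 -> R -> R) (K : R) (c : 'I_k.+1 -> R[i]) :
  (0 < K)%R -> ~ aeq alpha f (fun=> 0%R) ->
  (forall x, D x -> normc (w x) = 1%R /\ f x = ((normc (f x))%:C%C * w x)%R) ->
  (forall i, exists A B : set R, exists a b, [/\ measurable A /\ A `<=` D, measurable B /\ B `<=` D,
       0 < m A /\ 0 < m B, (0 < a)%R /\ (0 < b)%R &
       (forall x, A x -> forall j, u j x = if j == i then a else 0)%R /\
       (forall x, B x -> forall j, u j x = if j == i then - b else 0)%R]) ->
  aeq alpha (fun t => \sum_i c i * (f t + (K * (u i t - mean u t))%:C%C * w t))%R (fun=> 0%R) ->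
  forall i, c i = 0%R.
Proof.
move=> K0 fn0 fw poles c0.
pose C : R[i] := (\sum_i c i)%R.
pose d i : R[i] := (c i - (k.+1%:R)^-1 * C)%R.
have eqn : {ae m, forall t, D t -> (C * (normc (f t))%:C%C +
    K%:C%C * \sum_i d i * (u i t)%:C%C = 0)%R}.
  apply: (ae_imp c0) => t {}c0 Dt; have [wt1 fwt] := fw t Dt.
  have : ((C * (normc (f t))%:C%C + K%:C%C * \sum_i d i * (u i t)%:C%C) * w t = 0)%R.
    rewrite -[RHS](c0 Dt) /d /C -(sum_centered c (fun i => u i t)) mulr_sumr mulr_suml -big_split/= mulr_suml.
    by apply: eq_bigr => i _; rewrite {2}fwt rmorphM/= /mean; ring.
  move=> /eqP; rewrite mulf_eq0 => /orP[/eqP//|/eqP wt].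
  by move: wt1; rewrite wt normc0 => /esym/eqP; rewrite oner_eq0.
have Kc : (K%:C%C : R[i])%R != 0%R by rewrite complexR_eq0 gt_eqF.
have pole i (P : set R) (p : R) : measurable P -> P `<=` D -> 0 < m P ->
    (forall x, P x -> forall j, u j x = if j == i then p else 0)%R ->
    exists s, (C * (normc (f s))%:C%C + K%:C%C * (d i * p%:C%C) = 0)%R.
  move=> mP PD P0 up; have [s [Ps eqs]] := ae_point mP P0 eqn; exists s.
  move: (eqs (PD _ Ps)); rewrite (bigD1 i)//= (up _ Ps) eqxx big1 ?addr0// => j /negbTE ji.
  by rewrite (up _ Ps) ji mulr0.
have C_or i : C = 0%R \/ d i = 0%R.
  have [C0|C0] := eqVneq C 0%R; [by left|right].
  have [A [B [a [b [[mA AD] [mB BD] [A0 B0] [a0 b0] [uA uB]]]]]] := poles i.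
  have [s Hs] := pole i A a mA AD A0 uA; have [s' Hs'] := pole i B _ mB BD B0 uB.
  have : (C * (normc (f s) * b + normc (f s') * a)%:C%C = 0)%R.
    transitivity (b%:C%C * (C * (normc (f s))%:C%C + K%:C%C * (d i * a%:C%C)) +
       a%:C%C * (C * (normc (f s'))%:C%C + K%:C%C * (d i * (- b)%:C%C)))%R.
      by rewrite rmorphD !rmorphM rmorphN/=; ring.
    by rewrite Hs Hs' !mulr0 addr0.
  move=> /eqP; rewrite mulf_eq0 (negbTE C0)/= complexR_eq0.
  rewrite paddr_eq0 ?mulr_ge0 ?normc_ge0 ?(ltW a0) ?(ltW b0)// => /andP[+ _].
  rewrite mulf_eq0 (gt_eqF b0) orbF => /eqP fs.
  move: Hs; rewrite fs mulr0 add0r => /eqP; rewrite mulf_eq0 (negbTE Kc)/=.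
  by rewrite mulf_eq0 complexR_eq0 (gt_eqF a0) orbF => /eqP.
have C0 : C = 0%R.
  apply: contrapT => C0; apply: fn0.
  apply: (ae_imp eqn) => t {}eqn Dt; move: (eqn Dt).
  rewrite big1 => [|i _]; last by case: (C_or i) => // ->; rewrite mul0r.
  rewrite mulr0 addr0 => /eqP; rewrite mulf_eq0 => /orP[/eqP//|].
  by rewrite complexR_eq0 => /eqP /eq0_normc.
move=> i; have dc : d i = c i by rewrite /d C0 mulr0 subr0.
have [A [_ [a [_ [[mA AD] _ [A0 _] [a0 _] [uA _]]]]]] := poles i.
have [s] := pole i A a mA AD A0 uA.
rewrite C0 mul0r add0r dc => /eqP; rewrite mulf_eq0 (negbTE Kc)/=.
by rewrite mulf_eq0 complexR_eq0 (gt_eqF a0) orbF => /eqP.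
Qed.

(** If the excess of f stays away from that of g at all levels close to the values
    of |f| on E, then the mass of |f| can be moved around inside E along k + 1 centered
    dipoles, whose sum is 0, without leaving the orbit. *)
Lemma perturb_not_k_extreme g f k (E : set R) (bnd a b e d : R) :
  L1_plus_Linfty alpha g -> ~ aeq alpha g (fun=> 0%R) -> (0 < k)%N ->
  marcinkiewicz_sphere alpha g f ->
  measurable E -> E `<=` D -> E `<=` `[0%R, bnd] -> 0 < m E ->
  (forall x, E x -> (a <= normc (f x) <= b)%R) -> (0 < e)%R -> (0 < d)%R ->
  (forall l, (0 <= l)%R -> (a - e <= l <= b + e)%R ->
    excess alpha f l + d%:E <= excess alpha g l) ->
  ~ k_extreme_point alpha g k f.
Proof.
move=> gL gn0; case: k => // k _ fS mE ED Eb E0 fE e0 d0 gap [_ fk].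
have fO : Omega alpha g f by have /(sphereP _ gL gn0)[] := fS.
have f0 : L0 alpha f by case: fO => -[].
have [w w0 fw] := phaseP f0.
have [U [V [mUV iUV [S S0 UVS] offE poles]]] := dipoles k.+1 mE ED Eb E0.
have mU i : measurable_fun D (U i) by have [] := mUV i.
have mV i : measurable_fun D (V i) by have [] := mUV i.
have iU i : \int[m]_(x in D) (U i x)%:E = 1 by have [] := iUV i.
have iV i : \int[m]_(x in D) (V i x)%:E = 1 by have [] := iUV i.
have US i x : (0 <= U i x <= S)%R by have [] := UVS i x.
have VS i x : (0 <= V i x <= S)%R by have [] := UVS i x.
have U0 i x : (0 <= U i x)%R by have /andP[] := US i x.
have V0 i x : (0 <= V i x)%R by have /andP[] := VS i x.
have mU0 x : (0 <= mean U x)%R by have /andP[] := mean_bounds (US^~ x).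
have mV0 x : (0 <= mean V x)%R by have /andP[] := mean_bounds (VS^~ x).
(* the factor keeps the perturbations below e and their cost K + K + K + K below d *)
pose K : R := Num.min (e / (S + S))%R (d / 4)%R.
have SS : (0 < S + S)%R by rewrite addr_gt0.
have K0 : (0 < K)%R by rewrite lt_min !divr_gt0.
have Ke : (K * (S + S) <= e)%R by rewrite -ler_pdivlMr// ge_min lexx.
have Kd : (4 * K <= d)%R by rewrite mulrC -ler_pdivlMr// ge_min lexx orbT.
pose p i x : R := (K * (U i x + mean V x))%R.
pose n i x : R := (K * (V i x + mean U x))%R.
have bound (u v : R) : (0 <= u <= S)%R -> (0 <= v <= S)%R -> (0 <= K * (u + v) <= e)%R.
  move=> /andP[u0 uS] /andP[v0 vS]; rewrite mulr_ge0 ?addr_ge0 ?(ltW K0)//=.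
  by apply: le_trans Ke; rewrite ler_pM2l// lerD.
have mp i : measurable_fun D (p i).
  by apply: measurable_funM => //; apply: measurable_funD => //; exact: measurable_mean.
have mn i : measurable_fun D (n i).
  by apply: measurable_funM => //; apply: measurable_funD => //; exact: measurable_mean.
have ip i : \int[m]_(x in D) (p i x)%:E = (K + K)%:E.
  by apply: integral_scaled_sum => //; [exact: ltW|exact: measurable_mean|exact: integral_mean].
have inn i : \int[m]_(x in D) (n i x)%:E = (K + K)%:E.
  by apply: integral_scaled_sum => //; [exact: ltW|exact: measurable_mean|exact: integral_mean].
pose x i t := (f t + (p i t - n i t)%:C%C * w t)%R.
have xO i : Omega alpha g (x i).
  apply: (@Omega_perturb _ _ f g w (p i) (n i) a b (K + K)%R e) => //.
  - by move=> t _; apply: bound => //; exact: mean_bounds.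
  - by move=> t _; apply: bound => //; exact: mean_bounds.
  - move=> t Dt; have [Et|nEt] := pselect (E t); [by right; exact: fE|left].
    rewrite /p /n /mean !big1; first by rewrite (offE _ _ nEt).1 (offE _ _ nEt).2 !mulr0 addr0 mulr0.
      by move=> j _; rewrite (offE _ _ nEt).1.
    by move=> j _; rewrite (offE _ _ nEt).2.
  move=> l l0 labe; apply: le_trans (gap l l0 labe).
  by apply: leeD2l; rewrite lee_fin; lra.
pose u i t : R := (U i t - V i t)%R.
have phiE i t : (p i t - n i t = K * (u i t - mean u t))%R.
  by rewrite /p /n /u /mean sumrB; ring.
have favg : aeq alpha f (fun t => (k.+2%:R)^-1 * \sum_(i < k.+2) x i t)%R.
  apply: aeW => t Dt; rewrite big_split/= sumr_const card_ord -mulr_suml.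
  have -> : (\sum_i (p i t - n i t)%:C%C = 0 :> R[i])%R.
    rewrite -rmorph_sum/= (eq_bigr _ (fun i _ => phiE i t)) -mulr_sumr sumrB sumr_const card_ord.
    rewrite /mean -[X in (_ - X)%R]mulr_natl mulrA mulfV ?pnatr_eq0// mul1r subrr mulr0//.
  by rewrite mul0r addr0 -[X in (_ * X)%R]mulr_natl mulrA mulVf ?pnatr_eq0// mul1r.
have [c [[i0 ci0] c0]] := fk x (avg_sphere gL gn0 fS xO favg) favg.
apply: ci0; apply: (@dipoles_independent _ f w u K c K0 (sphere_neq0 gL gn0 fS) fw poles).
apply: (ae_imp c0) => t {}c0 Dt.
transitivity (\sum_i c i * x i t)%R; last exact: c0.
by apply: eq_bigr => i _; rewrite /x phiE.
Qed.

End Family.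

(** * k-extreme points are equimeasurable with g *)

Section KExtreme.
Context {R : realType} (alpha : \bar R).
Local Notation m := (@lebesgue_measure R).
Local Notation D := (Ico0 alpha).
Implicit Types (f g h w : R -> R[i]) (a b c e l r s t : R).

(** Chebyshev inequality. *)
Lemma excess_ge_shift f l l' : L0 alpha f -> (l <= l')%R ->
  (l' - l)%:E * distribution_fun alpha f l' <= excess alpha f l.
Proof.
move=> f0 ll'; have l'l : (0 <= l' - l)%R by rewrite subr_ge0.
have mD := measurable_Ico0 alpha.
pose A := D `&` [set x | (l' < normc (f x))%R].
have mA : measurable A by exact: measurable_superlevel.
have -> : distribution_fun alpha f l' = \int[m]_(x in D) (\1_A x)%:E.
  rewrite integral_indic//.
  by congr (m _); apply/seteqP; split => x; [move=> [Dx fx]|case=> [[]]].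
rewrite -ge0_integralZl_EFin//; last first.
  by apply/measurable_EFinP; exact: measurable_indic.
apply: ge0_le_integral => //.
- by move=> x _; rewrite mule_ge0// lee_fin.
- by apply: emeasurable_funM => //; apply/measurable_EFinP; exact: measurable_indic.
- exact: measurable_excess.
move=> x Dx; rewrite -EFinM lee_fin indicE le_max.
have [/set_mem[_ /= fx]|_] := boolP (x \in A).
  by rewrite mulr1 lerD2r ltW.
by rewrite mulr0 lexx orbT.
Qed.

Lemma excess_eqy f l l' : L0 alpha f -> (l < l')%R ->
  distribution_fun alpha f l' = +oo -> excess alpha f l = +oo.
Proof.
move=> f0 ll' fl'; apply/eqP; rewrite -leye_eq.
apply: le_trans (excess_ge_shift f0 (ltW ll')).
by rewrite fl' gt0_muley// lte_fin subr_gt0.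
Qed.

Lemma distribution_eqy f l : L0 alpha f -> (0 <= l)%R ->
  l%:E < rearr_infty alpha f -> distribution_fun alpha f l = +oo.
Proof.
move=> f0 l0 fl.
have H t : t%:E < distribution_fun alpha f l.
  by rewrite -lt_rearr//; apply: lt_le_trans fl _; exact: rearr_infty_le.
move: H; case: (distribution_fun alpha f l) => [d H|//|/(_ 0%R)]//.
by have := H d; rewrite ltxx.
Qed.

Lemma rearr_infty_fin f : L1_plus_Linfty alpha f ->
  rearr_infty alpha f = (fine (rearr_infty alpha f))%:E.
Proof.
move=> fL; rewrite fineK// ge0_fin_numE ?rearr_infty_ge0//.
by apply: le_lt_trans (rearr_infty_le alpha f 1%R) _; exact: rearr_fin.
Qed.

(** Below rearr_infty the excess of f is infinite, hence so is that of g. On a set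
    where |f| stays away from rearr_infty from below, perturb_not_k_extreme therefore
    applies. *)
Lemma k_extreme_ge_rearr_infty g f k : L1_plus_Linfty alpha g ->
  ~ aeq alpha g (fun=> 0%R) -> (0 < k)%N -> L1_plus_Linfty alpha f ->
  k_extreme_point alpha g k f ->
  {ae m, forall x, D x -> rearr_infty alpha f <= (normc (f x))%:E}.
Proof.
move=> gL gn0 k0 fL fk; have f0 : L0 alpha f by case: fL.
have fS : marcinkiewicz_sphere alpha g f by case: fk.
have [fO _] := (sphereP f gL gn0).1 fS.
have [_ fg] := (OmegaP f gL).1 fO.
pose M : R := fine (rearr_infty alpha f).
have ME : rearr_infty alpha f = M%:E by exact: rearr_infty_fin.
rewrite ME.
pose B (n : nat) := D `\` (D `&` [set x | (M - 2 * (n.+1%:R)^-1 < normc (f x))%R]).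
have mB n : measurable (B n).
  by apply: measurableD; [exact: measurable_Ico0|exact: measurable_superlevel].
apply: contrapT => notae.
have [n Bn] : exists n, 0 < m (B n).
  apply: measure_bigcup_gt0 => //; rewrite lt0e measure_ge0 andbT; apply/eqP => B0.
  have mU : measurable (\bigcup_n B n) by exact: bigcup_measurable.
  apply: notae; exists (\bigcup_n B n); split => //.
  move=> x /= /not_implyP[Dx]; rewrite lee_fin => /negP; rewrite -ltNge => fM.
  have := fM; rewrite -subr_gt0 => fM'.
  have /ltr_add_invr[n] : (0 < (M - normc (f x)) / 2)%R by rewrite divr_gt0.
  rewrite add0r => nf; exists n => //; split => // -[_ /=]; apply/negP.
  by move: nf; rewrite -leNgt; set q := (_^-1)%R => nf; lra.
have BD : B n `<=` D by move=> x [].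
have [N EN] : exists N : nat, 0 < m (B n `&` `[0%R, N%:R]).
  by apply: bounded_subset_gt0 => // x /BD [].
pose e : R := (n.+1%:R^-1)%R.
have e0 : (0 < e)%R by rewrite invr_gt0.
have mE : measurable (B n `&` `[0%R, N%:R]) by exact: measurableI.
have ED : B n `&` `[0%R, N%:R] `<=` D by move=> x [/BD].
have fE x : (B n `&` `[0%R, N%:R]) x -> (0 <= normc (f x) <= M - 2 * e)%R.
  move=> [[Dx nf] _]; rewrite normc_ge0/= leNgt; apply/negP => ff.
  by apply: nf.
apply: (perturb_not_k_extreme gL gn0 k0 fS mE ED (@subIsetr _ _ _) EN fE e0 ltr01) fk.
move=> l l0 /andP[_ lM].
have fl : excess alpha f l = +oo.
  have ll : (l < l + e / 2)%R by lra.
  apply: (excess_eqy f0 ll); apply: (distribution_eqy f0); first by lra.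
  by rewrite ME lte_fin; lra.
have gy : excess alpha g l = +oo by apply/eqP; rewrite -leye_eq -fl; exact: fg.
by rewrite gy leey.
Qed.

Lemma int_rearr_addl f t e : (0 <= t)%R -> (0 <= e)%R ->
  int_rearr alpha f (t + e) =
  int_rearr alpha f t + \int[m]_(s in `]t, (t + e)%R]) rearr alpha f s.
Proof.
move=> t0 e0; rewrite /int_rearr -ge0_integral_setU//.
- congr (integral _ _ _); apply/seteqP; split => s /=; rewrite !in_itv/=.
    by move=> /andP[-> ste]; case: (leP s t) => st; [left|right; rewrite ste].
  by case=> /andP[A B]; rewrite ?B ?A/=; lra.
- by apply: measurable_funTS; exact: measurable_rearr.
- by move=> s _; exact: rearr_ge0.
- apply/disj_setPS => s [] /=; rewrite !in_itv/= => /andP[_ st] /andP[ts _].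
  by move: st; rewrite leNgt ts.
Qed.

Local Opaque int_rearr rearr.

Lemma integral_rearr_itv_ge f t e c : (0 <= t)%R -> (0 <= e)%R -> (0 <= c)%R ->
  c%:E <= rearr alpha f (t + e) ->
  (c * e)%:E <= \int[m]_(s in `]t, (t + e)%R]) rearr alpha f s.
Proof.
move=> t0 e0 c0 cf.
have -> : (c * e)%:E = \int[m]_(s in `]t, (t + e)%R]) cst c%:E s.
  rewrite integral_cst//= lebesgue_measure_itv/= lte_fin.
  by case: ltP => te; [rewrite -EFinB -EFinM; congr (_%:E); ring|
    rewrite mule0; congr (_%:E); rewrite (_ : e = 0%R) ?mulr0//; lra].
apply: ge0_le_integral => //.
- by apply: measurable_funTS; exact: measurable_rearr.
move=> s; rewrite /= in_itv/= => /andP[_ ste]; apply: (le_trans cf).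
exact: rearr_nonincreasing.
Qed.

Lemma integral_rearr_itv_le f t e c : (0 <= t)%R -> (0 <= e)%R -> (0 <= c)%R ->
  rearr alpha f t <= c%:E ->
  \int[m]_(s in `]t, (t + e)%R]) rearr alpha f s <= (c * e)%:E.
Proof.
move=> t0 e0 c0 cf.
have -> : (c * e)%:E = \int[m]_(s in `]t, (t + e)%R]) cst c%:E s.
  rewrite integral_cst//= lebesgue_measure_itv/= lte_fin.
  by case: ltP => te; [rewrite -EFinB -EFinM; congr (_%:E); ring|
    rewrite mule0; congr (_%:E); rewrite (_ : e = 0%R) ?mulr0//; lra].
apply: ge0_le_integral => //.
- by move=> s _; exact: rearr_ge0.
- by apply: measurable_funTS; exact: measurable_rearr.
move=> s; rewrite /= in_itv/= => /andP[ts _]; apply: le_trans cf.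
by apply: rearr_nonincreasing; exact: ltW.
Qed.

(** If rearr f t > s >= rearr g t, then int_rearr f grows strictly faster than
    int_rearr g just after t, by right continuity of rearr f. *)
Lemma rearr_ltS f g t s : L1_plus_Linfty alpha f -> L1_plus_Linfty alpha g ->
  (forall t, (0 <= t)%R -> t%:E < alpha -> int_rearr alpha f t = int_rearr alpha g t) ->
  (0 <= t)%R -> t%:E < alpha -> (0 <= s)%R ->
  s%:E < rearr alpha f t -> s%:E < rearr alpha g t.
Proof.
move=> fL gL fg t0 ta s0; have f0 : L0 alpha f by case: fL.
rewrite lt_rearr// => /(distribution_lsc f0)[s' ss' ts'].
have [e1 e10 te1] := lt_EFin_shift ts'; have [e2 e20 te2] := lt_EFin_shift ta.
pose e := Num.min e1 e2.
have e0 : (0 < e)%R by rewrite lt_min e10.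
have ee1 : (e <= e1)%R by rewrite ge_min lexx.
have ee2 : (e <= e2)%R by rewrite ge_min lexx orbT.
have s'0 : (0 <= s')%R by lra.
have gfin : int_rearr alpha g t \is a fin_num.
  by rewrite ge0_fin_numE ?int_rearr_ge0// int_rearr_fin.
have F : (s' * e)%:E <= \int[m]_(r in `]t, (t + e)%R]) rearr alpha f r.
  apply: integral_rearr_itv_ge => //; first exact: ltW.
  apply: ltW; rewrite lt_rearr//; apply: le_lt_trans te1.
  by rewrite lee_fin lerD2l.
rewrite ltNge; apply/negP => gs.
have G := integral_rearr_itv_le t0 (ltW e0) s0 gs.
have te0 : (0 <= t + e)%R by lra.
have tea : (t + e)%:E < alpha by apply: le_lt_trans te2; rewrite lee_fin lerD2l.
have E := fg _ te0 tea.
rewrite (int_rearr_addl f t0 (ltW e0)) (int_rearr_addl g t0 (ltW e0)) in E.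
rewrite (fg t t0 ta) in E.
rewrite (adde_cancel gfin E) in F.
move: (le_trans F G) => {F G E}.
by rewrite lee_fin (ler_pM2r e0) leNgt ss'.
Qed.

Lemma rearr_out f t : 0 <= alpha -> L0 alpha f -> alpha <= t%:E -> rearr alpha f t = 0.
Proof.
move=> a0 f0 at_; apply/le_anti/andP; split; last exact: rearr_ge0.
rewrite leNgt lt_rearr// -leNgt; apply: le_trans at_.
rewrite -[leRHS]lebesgue_measure_Ico0//; apply: le_measure; rewrite ?inE.
- exact: measurable_superlevel.
- exact: measurable_Ico0.
- by move=> x [].
Qed.

Lemma eq_rearr_of_int f g : 0 < alpha -> L1_plus_Linfty alpha f -> L1_plus_Linfty alpha g ->
  (forall t, (0 < t)%R -> t%:E < alpha -> int_rearr alpha f t = int_rearr alpha g t) ->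
  forall t, (0 <= t)%R -> rearr alpha f t = rearr alpha g t.
Proof.
move=> a0 fL gL fg t t0.
have f0 : L0 alpha f by case: fL.
have g0 : L0 alpha g by case: gL.
have [ta|at_] := ltP t%:E alpha; last by rewrite !rearr_out// ltW.
have {}fg u : (0 <= u)%R -> u%:E < alpha -> int_rearr alpha f u = int_rearr alpha g u.
  by rewrite le_eqVlt => /predU1P[<-|/fg//]; rewrite !int_rearr0.
apply: eq_lte_EFin; [exact: rearr_ge0|exact: rearr_ge0|move=> s s0].
apply/idP/idP; first exact: (rearr_ltS fL gL fg t0 ta s0).
exact: (rearr_ltS gL fL (fun u u0 ua => esym (fg u u0 ua)) t0 ta s0).
Qed.

(** There is more mass than t above the level c - e, and at most t above c + e. *)
Lemma essential_value f t c e : 0 <= alpha -> L0 alpha f -> (0 <= t)%R -> t%:E < alpha ->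
  rearr alpha f t = c%:E -> (0 < e)%R ->
  0 < m ((D `&` [set x | (c - e < normc (f x))%R]) `\`
         (D `&` [set x | (c + e < normc (f x))%R])).
Proof.
move=> a0 f0 t0 ta ft e0.
set A := D `&` _; set B := D `&` _.
have mA : measurable A by exact: measurable_superlevel.
have mB : measurable B by exact: measurable_superlevel.
have c0 : (0 <= c)%R by rewrite -lee_fin -ft rearr_ge0.
have tA : t%:E < m A.
  have [ce|ce] := leP 0%R (c - e)%R.
    by rewrite -[m A]/(distribution_fun alpha f (c - e)) -lt_rearr// ft lte_fin; lra.
  rewrite (_ : A = D) ?lebesgue_measure_Ico0//.
  apply/seteqP; split => x; first by case.
  by move=> Dx; split => //=; apply: lt_le_trans ce (normc_ge0 _).
have Bt : m B <= t%:E.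
  rewrite leNgt -[m B]/(distribution_fun alpha f (c + e)) -lt_rearr//; last by lra.
  by rewrite ft lte_fin -leNgt; lra.
rewrite lt0e measure_ge0 andbT; apply/eqP => AB0.
move: tA; rewrite ltNge => /negP; apply; apply: le_trans Bt.
have mAB : measurable (A `\` B) by exact: measurableD.
apply: (@le_trans _ _ (m ((A `\` B) `|` B))).
  apply: le_measure; rewrite ?inE//; first exact: measurableU.
  by move=> x Ax; have [Bx|nB] := pselect (B x); [right|left].
apply: le_trans (@measureU2 _ _ _ m _ _ mAB mB) _.
by rewrite [X in X + _]AB0 add0e.
Qed.

(** By duality excess f c = int_rearr f t - t c < int_rearr g t - t c <= excess g c
    at the level c = rearr f t. The gap persists at nearby levels: the lower bound
    int_rearr g t - t l for excess g l is continuous in l, and excess f is continuous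
    from the left at c unless it is infinite at all lower levels, where excess g is
    then infinite as well. *)
Lemma excess_gap f g t c : L1_plus_Linfty alpha f -> L1_plus_Linfty alpha g ->
  (forall l, (0 <= l)%R -> excess alpha f l <= excess alpha g l) ->
  (0 < t)%R -> rearr alpha f t = c%:E -> int_rearr alpha f t < int_rearr alpha g t ->
  exists e d, [/\ (0 < e)%R, (0 < d)%R & forall l, (0 <= l)%R ->
    (c - e <= l <= c + e)%R -> excess alpha f l + d%:E <= excess alpha g l].
Proof.
move=> fL gL fg t0 ft; have f0 : L0 alpha f by case: fL.
have g0 : L0 alpha g by case: gL.
have c0 : (0 <= c)%R by rewrite -lee_fin -ft rearr_ge0.
have Ft := int_rearr_eq_excess f0 (ltW t0) ft.
have := int_rearr_fin gL (ltW t0); have := int_rearr_ge0 alpha g t.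
case Gt : (int_rearr alpha g t) => [y| |]// _ _.
rewrite Ft; have := excess_ge0 alpha f c.
case fc : (excess alpha f c) => [x| |]// _; rewrite -EFinD lte_fin => gapc.
have gl l : (0 <= l)%R -> (y - t * l)%:E <= excess alpha g l.
  by move=> l0; rewrite EFinB leeBlDl// -Gt; apply: int_rearr_le_excess => //; exact: ltW.
pose d : R := ((y - (t * c + x)) / 2)%R.
have d0 : (0 < d)%R by rewrite /d; lra.
have y2 : (y = t * c + x + d + d)%R by rewrite /d; lra.
have [e2 e20 He2] : exists2 e2, (0 < e2)%R & forall l, (0 <= l)%R -> (l < c)%R ->
    (c - e2 <= l)%R -> excess alpha f l + d%:E <= excess alpha g l.
  have [[l2 [l20 l2c dl2]]|nol2] :=
      pselect (exists l2, [/\ (0 <= l2)%R, (l2 < c)%R & distribution_fun alpha f l2 < +oo]).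
    have := distribution_ge0 alpha f l2.
    case dE : (distribution_fun alpha f l2) dl2 => [v| |]// _ v0; rewrite lee_fin in v0.
    have v1 : (0 < v + 1)%R by lra.
    (* v + 1 rather than v, which may be 0 *)
    exists (Num.min (c - l2) (d / (v + 1)))%R; first by rewrite lt_min subr_gt0 l2c divr_gt0.
    move=> l l0 lc cl.
    have l2l : (l2 <= l)%R.
      by have : (Num.min (c - l2) (d / (v + 1)) <= c - l2)%R by [rewrite ge_min lexx]; lra.
    have cld : ((c - l) * (v + 1) <= d)%R.
      rewrite -ler_pdivlMr//.
      by have : (Num.min (c - l2) (d / (v + 1)) <= d / (v + 1))%R by [rewrite ge_min lexx orbT]; lra.
    apply: (@le_trans _ _ (x + (c - l) * v + d)%:E); last first.
      apply: le_trans (gl l l0); rewrite lee_fin y2.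
      have tl : (t * l <= t * c)%R by rewrite ler_pM2l// ltW.
      by have : ((c - l) * v <= (c - l) * (v + 1))%R by [rewrite ler_wpM2l// ?subr_ge0; lra]; lra.
    rewrite EFinD; apply: leeD2r; rewrite EFinD -fc.
    apply: le_trans (excess_le_shift f0 (ltW lc)) _.
    apply: leeD2l; rewrite EFinM; apply: lee_wpmul2l; first by rewrite lee_fin subr_ge0 ltW.
    by rewrite -dE; exact: le_distribution.
  exists 1%R => // l l0 lc _.
  have fl : excess alpha f l = +oo.
    have lm : (l < (l + c) / 2)%R by lra.
    apply: (excess_eqy f0 lm); apply/eqP; rewrite -leye_eq leNgt; apply/negP => dd.
    by apply: nol2; exists ((l + c) / 2)%R; split => //; lra.
  have gy : excess alpha g l = +oo by apply/eqP; rewrite -leye_eq -fl; exact: fg.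
  by rewrite gy leey.
exists (Num.min e2 (d / t))%R, d; split => //; first by rewrite lt_min e20 divr_gt0.
move=> l l0 /andP[cl lc]; have [ltc|cel] := ltP l c.
  apply: He2 => //.
  by have : (Num.min e2 (d / t) <= e2)%R by [rewrite ge_min lexx]; lra.
have lcd : ((l - c) * t <= d)%R.
  rewrite -ler_pdivlMr//.
  by have : (Num.min e2 (d / t) <= d / t)%R by [rewrite ge_min lexx orbT]; lra.
apply: (@le_trans _ _ (x + d)%:E).
  by rewrite EFinD; apply: leeD2r; rewrite -fc; exact: le_excess.
by apply: le_trans (gl l l0); rewrite lee_fin y2; lra.
Qed.

(** If the integrated rearrangements differed at t, there would be room between the
    excess functionals near c = rearr f t, while |f| takes values close to c on a set
    of positive measure. *)
Lemma k_extreme_eq_rearr g f k : 0 < alpha -> L1_plus_Linfty alpha g ->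
  ~ aeq alpha g (fun=> 0%R) -> (0 < k)%N -> L1_plus_Linfty alpha f ->
  k_extreme_point alpha g k f ->
  forall t, (0 <= t)%R -> rearr alpha f t = rearr alpha g t.
Proof.
move=> a0 gL gn0 k0 fL fk; have f0 : L0 alpha f by case: fL.
have fS : marcinkiewicz_sphere alpha g f by case: fk.
have [fO _] := (sphereP f gL gn0).1 fS.
have [_ fg] := (OmegaP f gL).1 fO.
apply: (eq_rearr_of_int a0 fL gL) => t t0 ta; apply/le_anti/andP.
have [_ fsub] := fO; split; first exact: (fsub t t0).
rewrite leNgt; apply/negP => FG.
pose c : R := fine (rearr alpha f t).
have ft : rearr alpha f t = c%:E by rewrite fineK// rearr_fin_num.
have [e [d [e0 d0 gap]]] := excess_gap fL gL fg t0 ft FG.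
have e2 : (0 < e / 2)%R by rewrite divr_gt0.
have := essential_value (ltW a0) f0 (ltW t0) ta ft e2.
set B := _ `\` _ => B0.
have mB : measurable B by apply: measurableD; exact: measurable_superlevel.
have BD : B `<=` D by move=> x [[]].
have [N EN] : exists N : nat, 0 < m (B `&` `[0%R, N%:R]).
  by apply: bounded_subset_gt0 => // x /BD [].
have mE : measurable (B `&` `[0%R, N%:R]) by exact: measurableI.
have ED : B `&` `[0%R, N%:R] `<=` D by move=> x [/BD].
have fE x : (B `&` `[0%R, N%:R]) x -> (c - e / 2 <= normc (f x) <= c + e / 2)%R.
  move=> [[[Dx /= cf] nf] _]; rewrite (ltW cf)/= leNgt; apply/negP => ff.
  by apply: nf.
apply: (perturb_not_k_extreme gL gn0 k0 fS mE ED (@subIsetr _ _ _) EN fE e2 d0) fk.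
by move=> l l0 /andP[cl lc]; apply: (gap l l0); apply/andP; split; lra.
Qed.

End KExtreme.

(** * The rearrangement as an element of the space *)

Section RearrangementAsFunction.
Context {R : realType} (alpha : \bar R).
Local Notation m := (@lebesgue_measure R).
Local Notation D := (Ico0 alpha).
Implicit Types (f g h w : R -> R[i]) (a b c e l r s t : R).

Lemma normc_rearrC f t : L1_plus_Linfty alpha f -> (0 < t)%R ->
  (normc (rearrC alpha f t))%:E = rearr alpha f t.
Proof.
move=> fL t0; rewrite normc_real ger0_norm ?fine_ge0 ?rearr_ge0//.
by rewrite fineK// rearr_fin_num.
Qed.

Lemma L0_rearrC f : L0 alpha (rearrC alpha f).
Proof.
split; last exact: measurable_cst.
apply: measurable_funTS; apply: (measurableT_comp (fine_measurable measurableT)).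
exact: measurable_rearr.
Qed.

(** By lt_rearr the superlevel sets of the rearrangement are the intervals
    [0, d(s, f)[; the point 0 has to be set aside because rearr alpha f 0 may be
    infinite. *)
Lemma distribution_rearrC f s : 0 <= alpha -> L1_plus_Linfty alpha f -> (0 <= s)%R ->
  distribution_fun alpha (rearrC alpha f) s = distribution_fun alpha f s.
Proof.
move=> a0 fL s0; have f0 : L0 alpha f by case: fL.
rewrite -[RHS]lebesgue_measure_Ico0 ?distribution_ge0//.
apply: eq_measure_off0.
- by apply: measurable_superlevel; exact: L0_rearrC.
- exact: measurable_Ico0.
have da : distribution_fun alpha f s <= alpha.
  rewrite -[leRHS]lebesgue_measure_Ico0//; apply: le_measure; rewrite ?inE.
  - exact: measurable_superlevel.
  - exact: measurable_Ico0.
  - by move=> x [].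
move=> t /eqP tn0; have tgt0 : (0 <= t)%R -> (0 < t)%R by rewrite lt_def tn0.
split.
  move=> [[/[dup] /tgt0 t0 t0' _] /= st]; split => //.
  by rewrite -lt_rearr// -normc_rearrC.
move=> [/[dup] /tgt0 t0 t0' td]; split; first by split => //; exact: lt_le_trans td da.
by rewrite /= -lte_fin normc_rearrC// lt_rearr.
Qed.

Lemma rearr_rearrC f : 0 <= alpha -> L1_plus_Linfty alpha f ->
  rearr alpha (rearrC alpha f) = rearr alpha f.
Proof.
move=> a0 fL; apply/funext => t; congr ereal_inf; apply/seteqP.
by split => _ [s [s0 sd] <-]; exists s => //; split => //;
  move: sd; rewrite distribution_rearrC// ltW.
Qed.

Lemma L1_plus_Linfty_rearrC f : 0 <= alpha -> L1_plus_Linfty alpha f ->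
  L1_plus_Linfty alpha (rearrC alpha f).
Proof.
move=> a0 fL; have f0 : L0 alpha f by case: fL.
have [l l0 fl] := L1_plus_Linfty_excess_fin fL.
apply: (excess_fin_L1_plus_Linfty (L0_rearrC f) l0).
rewrite (eq_rearr_excess (L0_rearrC f) f0 l0)// => t _.
by rewrite rearr_rearrC.
Qed.

Lemma rearrC_ge_rearr_infty f : 0 <= alpha -> L1_plus_Linfty alpha f ->
  {ae m, forall t, D t ->
    rearr_infty alpha (rearrC alpha f) <= (normc (rearrC alpha f t))%:E}.
Proof.
move=> a0 fL; apply: (ae_imp ae_neq0) => t /eqP t0 [t0' _].
rewrite normc_rearrC ?lt_def ?t0//.
by rewrite /rearr_infty rearr_rearrC//; exact: rearr_infty_le.
Qed.

End RearrangementAsFunction.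

Theorem theorem4p1 (R : realType) (alpha : \bar R) (halpha : 0 < alpha)
    (g : R -> R[i]) (hg : L1_plus_Linfty alpha g)
    (hg0 : ~ aeq alpha g (fun=> 0%R))
    (k : nat) (hk : (0 < k)%N)
    (f : R -> R[i]) (hf : L1_plus_Linfty alpha f) :
  [<-> extreme_point alpha (Omega alpha g) f;
       k_extreme_point alpha g k f;
       k_extreme_point alpha g k (rearrC alpha f) /\
         {ae @lebesgue_measure R, forall x, Ico0 alpha x ->
            rearr_infty alpha f <= (normc (f x))%:E};
       (forall t : R, (0 <= t)%R -> rearr alpha f t = rearr alpha g t) /\
         {ae @lebesgue_measure R, forall x, Ico0 alpha x ->
            rearr_infty alpha f <= (normc (f x))%:E}].
Proof.
have a0 := ltW halpha.
have hf' := L1_plus_Linfty_rearrC a0 hf.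
have mu_mu := rearr_rearrC a0 hf.
tfae.
- exact: extreme_k_extreme.
- move=> fk; split; last exact: (k_extreme_ge_rearr_infty hg hg0 hk hf fk).
  have fg := k_extreme_eq_rearr halpha hg hg0 hk hf fk.
  apply: (extreme_k_extreme hg hg0 hk).
  apply: (equimeasurable_extreme hf' hg) => [t t0|].
    by rewrite mu_mu; exact: (fg t t0).
  exact: (rearrC_ge_rearr_infty a0 hf).
- move=> [fk finf]; split => // t t0.
  by rewrite -mu_mu; exact: (k_extreme_eq_rearr halpha hg hg0 hk hf' fk t0).
- move=> [fg finf]; exact: (equimeasurable_extreme hf hg fg finf).
Qed.
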